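(* Let $A$ be a $Q$-periodic symmetric uniformly elliptic matrix and, for $\mu>0$ and $k\ge1$, let $A_{\mu,k}$ be the approximation of the homogenized matrix defined by the spectral formula in the context. Let $c_1=1$, $c_{k+1}=(2/c_k+1)^{-1}$. Define $\{a_{k,i}\}_{k\ge1,\,0\le i\le k-1}$ by $a_{1,0}=1$ and, for $k\ge1$, $$a_{k+1,0}=c_ka_{k,0},\qquad a_{k+1,i}=c_ka_{k,i}-2^{1-k}c_ka_{k,i-1}\ (1\le i\le k-1),\qquad a_{k+1,k}=-2^{1-k}c_ka_{k,k-1}.$$ Define coefficients $\{\eta_{k,i}\}_{k\ge1,\,0\le i<k}$ and $\{\nu_{k,i,j}\}_{k\ge2,\,0\le i<j<k}$ by $\eta_{1,0}=0$ and, for $k\ge1$, \begin{align*} \eta_{k+1,i}&=\eta_{k,i}+\big(2^{k(k-1)+i}-2^{k^2+1}\big)a_{k+1,i}^2 &&(0\le i\le k-1),\\ \eta_{k+1,k}&=-2^{k^2}a_{k+1,k}^2,\\ \nu_{k+1,i,k}&=\big(2^{k(k-1)+i}-3\times2^{k^2}\big)a_{k+1,i}a_{k+1,k}&&(0\le i\le k-1),\\ \nu_{k+1,i,j}&=\nu_{k,i,j}+\big(2^{k(k-1)}(2^i+2^j)-2^{k^2+2}\big)a_{k+1,i}a_{k+1,j}&&(0\le i<j\le k-1). \end{align*} Then for all $\mu>0$, $k\ge1$ and $\xi\in\mathbb{R}^d$, $$\xi\cdot A_{\mu,k}\xi=\langle(\xi+\nabla\phi_\mu)\cdot A(\xi+\nabla\phi_\mu)\rangle+\mu\sum_{i=0}^{k-1}\eta_{k,i}\langle\phi_{2^i\mu}^2\rangle+\mu\sum_{i=0}^{k-1}\sum_{j=i+1}^{k-1}\nu_{k,i,j}\langle\phi_{2^i\mu}\phi_{2^j\mu}\rangle,$$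 where $\phi_{2^i\mu}$ are the modified correctors associated with $\xi$.
   Context: $Q=(0,1)^d$ is the unit cube and $\langle h\rangle=\int_Qh\,dx$. $A:\mathbb{R}^d\to\mathcal{M}_d(\mathbb{R})$ is measurable, symmetric, $Q$-periodic, with $|A(x)\zeta|\le\beta|\zeta|$ and $\zeta\cdot A(x)\zeta\ge\alpha|\zeta|^2$ for a.e. $x$ and all $\zeta\in\mathbb{R}^d$, where $\beta\ge\alpha>0$. For $\mu>0$ the modified corrector $\phi_\mu\in H^1_{\mathrm{per}}(Q)$ associated with $\xi$ is the unique weak solution of $\mu\phi_\mu-\nabla\cdot A(\xi+\nabla\phi_\mu)=0$. Spectral measure: let $\mathcal{L}=-\nabla\cdot A\nabla$ with periodic boundary conditions on $L^2_0(Q)=\{v\in L^2(Q):\int_Qv=0\}$, with orthonormal eigenbasis $(\psi_i)_{i\ge1}\subset H^1_{\mathrm{per}}(Q)$ of $L_0^2(Q)$ and eigenvalues $0<\lambda_1\le\lambda_2\le\cdots$. For the local drift $\mathfrak{d}=\nabla\cdot A\xi\in H^{-1}_{\mathrm{per}}(Q)$, acting by $\langle\mathfrak{d},\psi\rangle=-\int_QA\xi\cdot\nabla\psi\,dx$, set $e_{\mathfrak{d}}=\sum_{i\ge1}\langle\mathfrak{d},\psi_i\rangle^2\delta_{\lambda_i}$. Definition of $A_{\mu,k}$: with $$P_k(\mu,\lambda)=\lambda^{-1}\Big((\mu+\lambda)^2(2\mu+\lambda)^2\cdots(2^{k-1}\mu+\lambda)^2-2^{k(k-1)}\mu^{2k}\Big),$$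 $A_{\mu,k}$ is the symmetric matrix with $$\xi\cdot A_{\mu,k}\xi=\langle\xi\cdot A\xi\rangle-\int_{\mathbb{R}^+}\frac{P_k(\mu,\lambda)}{(\mu+\lambda)^2(2\mu+\lambda)^2\cdots(2^{k-1}\mu+\lambda)^2}\,\mathrm{d}e_{\mathfrak{d}}(\lambda).$$ *)

(* Defs.v *)
From HB Require Import structures.
From mathcomp Require Import all_boot all_order all_algebra.
From mathcomp Require Import all_classical all_reals all_analysis.

Set Implicit Arguments.
Unset Strict Implicit.
Unset Printing Implicit Defensive.
Import Order.TTheory GRing.Theory Num.Theory.
Import numFieldNormedType.Exports.
Local Open Scope classical_set_scope.
Local Open Scope ring_scope.

Definition rV_display : measure_display.
Proof. exact. Qed.

Section measurable_rV.
Context (R : realType) (n : nat).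

Let coord (i : 'I_n) (x : 'rV[R]_n) : R := x ord0 i.

Let rV_set0 : g_sigma_preimage coord set0.
Proof. exact: sigma_algebra0. Qed.

Let rV_setC A : g_sigma_preimage coord A -> g_sigma_preimage coord (~` A).
Proof. exact: sigma_algebraC. Qed.

Let rV_bigcup (F : (set 'rV[R]_n)^nat) :
  (forall i, g_sigma_preimage coord (F i)) ->
  g_sigma_preimage coord (\bigcup_i (F i)).
Proof. exact: sigma_algebra_bigcup. Qed.

HB.instance Definition _ := @isMeasurable.Build rV_display
  'rV[R]_n (g_sigma_preimage coord) rV_set0 rV_setC rV_bigcup.

Lemma measurable_coord (i : 'I_n) :
  measurable_fun [set: 'rV[R]_n] (fun x : 'rV[R]_n => x ord0 i).
Proof.
move=> _ Y mY; rewrite setTI; apply: sub_sigma_algebra => /=.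
rewrite -bigcup_seq/=; exists i => /=; first by rewrite mem_index_enum.
by exists Y => //; rewrite setTI.
Qed.

Lemma measurable_fun_coordP (dT : measure_display) (T : measurableType dT)
    (f : T -> 'rV[R]_n) :
  measurable_fun [set: T] f <->
  forall i, measurable_fun [set: T] (fun t => f t ord0 i).
Proof.
split=> [mf i|mf]; first exact: measurableT_comp (measurable_coord i) mf.
have sub : g_sigma_preimage (fun i => coord i \o f) `<=` measurable.
  apply: smallest_sub; first exact: sigma_algebra_measurable.
  rewrite -bigcup_seq; apply: bigcup_sub => i _ A [B mB <-]; exact: mf.
by move=> _ A mA; apply: sub; rewrite g_sigma_preimage_comp; exists A.
Qed.

End measurable_rV.

Section lebesgue_rV.
Context (R : realType).

Definition cons_rV n (p : measurableTypeR R * 'rV[R]_n) : 'rV[R]_n.+1 :=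
  \row_i (if unlift ord0 i is Some j then p.2 ord0 j else p.1).

Definition uncons_rV n (x : 'rV[R]_n.+1) : measurableTypeR R * 'rV[R]_n :=
  (x ord0 ord0, \row_j x ord0 (lift ord0 j)).

Lemma cons_rVK n : cancel (@cons_rV n) (@uncons_rV n).
Proof.
case=> r x; rewrite /uncons_rV /cons_rV mxE unlift_none; congr pair.
by apply/rowP => j; rewrite !mxE liftK.
Qed.

Lemma measurable_cons_rV n : measurable_fun [set: measurableTypeR R * 'rV[R]_n] (@cons_rV n).
Proof.
apply/measurable_fun_coordP => i; rewrite /cons_rV.
case: (unliftP ord0 i) => [j ->|->].
- under eq_fun do rewrite mxE liftK.
  exact: measurableT_comp (measurable_coord j) measurable_snd.
- under eq_fun do rewrite mxE unlift_none.
  exact: measurable_fst.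
Qed.

Lemma measurable_uncons_rV n :
  measurable_fun [set: 'rV[R]_n.+1] (@uncons_rV n).
Proof.
apply: measurable_fun_pair; first exact: measurable_coord.
apply/measurable_fun_coordP => i.
by under eq_fun do rewrite mxE; exact: measurable_coord.
Qed.

Section step.
Context (n : nat) (m : {sigma_finite_measure set 'rV[R]_n -> \bar R}).

Definition lebesgue_rV_step : set 'rV[R]_n.+1 -> \bar R :=
  pushforward (@lebesgue_measure R \x m)%E (@cons_rV n).

Let step0 : lebesgue_rV_step set0 = 0%E.
Proof. by rewrite /lebesgue_rV_step /pushforward preimage_set0 measure0. Qed.

Let step_ge0 A : (0 <= lebesgue_rV_step A)%E.
Proof. by rewrite /lebesgue_rV_step /pushforward measure_ge0. Qed.

Let measurable_preimage A :
  measurable A -> measurable (@cons_rV n @^-1` A).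
Proof. by move=> mA; rewrite -[X in measurable X]setTI; exact: measurable_cons_rV. Qed.

Let step_sigma_additive : semi_sigma_additive lebesgue_rV_step.
Proof.
move=> F mF tF mUF; rewrite /lebesgue_rV_step /pushforward preimage_bigcup.
apply: measure_semi_sigma_additive.
- by move=> i; exact: measurable_preimage.
- apply/trivIsetP => /= i j _ _ ij; rewrite -preimage_setI.
  by move/trivIsetP : tF => /(_ _ _ _ _ ij) ->//; rewrite preimage_set0.
- by rewrite -preimage_bigcup; exact: measurable_preimage.
Qed.

HB.instance Definition _ := isMeasure.Build _ _ _ lebesgue_rV_step
  step0 step_ge0 step_sigma_additive.

Let step_sigma_finite : sigma_finite setT lebesgue_rV_step.
Proof.
have /sigma_finiteP[F [TF ndF Foo]] := sigma_finiteT (@lebesgue_measure R).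
have /sigma_finiteP[G [TG ndG Goo]] := sigma_finiteT m.
exists (fun k => @uncons_rV n @^-1` (F k `*` G k)).
  rewrite -preimage_bigcup -(preimage_setT (@uncons_rV n)); congr preimage.
  rewrite -setXTT TF TG predeqE => -[x y]; split => [[/=]|].
    move=> [i _ Fix] [j _ Gjy]; exists (maxn i j) => //; split => /=.
    - by move: x Fix; exact/subsetPset/ndF/leq_maxl.
    - by move: y Gjy; exact/subsetPset/ndG/leq_maxr.
  by move=> [k _ []/= ? ?]; split; exists k.
move=> k; have [mF Fk] := Foo k; have [mG Gk] := Goo k; split.
  rewrite -[X in measurable X]setTI; apply: measurable_uncons_rV => //.
  exact: measurableX.
rewrite /lebesgue_rV_step /pushforward -comp_preimage.
rewrite (_ : _ \o _ = id); last by apply/funext => p; exact: cons_rVK.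
by rewrite preimage_id [ltLHS]product_measure1E// lte_mul_pinfty// ge0_fin_numE.
Qed.

HB.instance Definition _ := Measure_isSigmaFinite.Build _ _ _
  lebesgue_rV_step step_sigma_finite.

End step.

Fixpoint lebesgue_rV (n : nat) : {sigma_finite_measure set 'rV[R]_n -> \bar R} :=
  match n with
  | 0 => dirac (0 : 'rV[R]_0)
  | n'.+1 => lebesgue_rV_step (lebesgue_rV n')
  end.

End lebesgue_rV.

Section rV_geometry.
Context (R : realType) (d : nat).
Implicit Types (x y : 'rV[R]_d) (i : 'I_d).

Definition dotV x y : R := \sum_i x ord0 i * y ord0 i.

(* Euclidean norm: the library norm on ['rV[R]_d] is the sup norm. *)
Definition enormV x : R := Num.sqrt (dotV x x).

(* The matrix-vector product, with vectors of R^d kept as rows. *)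
Definition appV (M : 'M[R]_d) x : 'rV[R]_d := x *m M^T.

Definition baseV i : 'rV[R]_d := delta_mx ord0 i.

Definition cube : set 'rV[R]_d := [set x | forall i, 0 < x ord0 i < 1].

Definition cube_periodic (T : Type) (f : 'rV[R]_d -> T) :=
  forall x i, f (x + baseV i) = f x.

Definition avg (h : 'rV[R]_d -> R) : R :=
  \int[lebesgue_rV R d]_(x in cube) h x.

End rV_geometry.

Section sobolev.
Context (R : realType) (d : nat).
Notation V := 'rV[R]_d.
Implicit Types (u v w h : V -> R) (g : V -> V).

Definition L2 h := measurable_fun (@cube R d) h /\
  (lebesgue_rV R d).-integrable (@cube R d) (fun x => (h x ^+ 2)%:E).

Definition L2_vec g := forall i, L2 (fun x => g x ord0 i).

Definition L2_mean0 h := L2 h /\ avg h = 0.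

Fixpoint Ck (k : nat) (f : V -> R) : Prop :=
  continuous f /\
  match k with
  | 0 => True
  | k'.+1 => forall i, (forall x, derivable f x (baseV R i)) /\
                       Ck k' (fun x => 'D_(baseV R i) f x)
  end.

Definition smooth_periodic (f : V -> R) :=
  (forall k, Ck k f) /\ cube_periodic f.

Definition grad (f : V -> R) : V -> V := fun x => \row_i 'D_(baseV R i) f x.

(* [H1per u g]: u belongs to H^1_per(Q), the closure of the smooth Q-periodic
   functions for the H^1(Q) norm, and g is its (weak) gradient, i.e. the
   L^2(Q) limit of the gradients of the approximating functions. *)
Definition H1per u g :=
  [/\ L2 u, L2_vec g &
   forall e : R, 0 < e -> exists2 f, smooth_periodic f &
     (\int[lebesgue_rV R d]_(x in @cube R d)
        ((u x - f x) ^+ 2 + enormV (g x - grad f x) ^+ 2)%:E < e%:E)%E].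

End sobolev.

Section homogenization.
Context (R : realType) (d : nat).
Notation V := 'rV[R]_d.
Implicit Types (A : V -> 'M[R]_d) (xi : V).

Record elliptic_coef (alpha beta : R) A : Prop := EllipticCoef {
  coef_bounds : 0 < alpha /\ alpha <= beta;
  coef_measurable : forall i j, measurable_fun [set: V] (fun x => A x i j);
  coef_sym : forall x, (A x)^T = A x;
  coef_periodic : cube_periodic A;
  coef_bounded : {ae lebesgue_rV R d, forall x, forall z : V,
    enormV (appV (A x) z) <= beta * enormV z};
  coef_coercive : {ae lebesgue_rV R d, forall x, forall z : V,
    alpha * enormV z ^+ 2 <= dotV z (appV (A x) z)} }.

(* Weak form of [mu phi - div A (xi + grad phi) = 0] in H^1_per(Q). *)
Definition modified_corrector A xi (mu : R) (phi : V -> R) (gphi : V -> V) :=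
  H1per phi gphi /\
  forall w gw, H1per w gw ->
    mu * avg (fun x => phi x * w x) +
    avg (fun x => dotV (appV (A x) (xi + gphi x)) (gw x)) = 0.

(* [psi] (with gradients [gpsi]) is an orthonormal basis of L^2_0(Q) made of
   eigenfunctions of [- div A grad], with eigenvalues [lam]; the eigenvalue
   equation is understood in the weak sense. *)
Record periodic_eigenbasis A (psi : nat -> V -> R) (gpsi : nat -> V -> V)
    (lam : nat -> R) : Prop := PeriodicEigenbasis {
  eigen_H1 : forall i, H1per (psi i) (gpsi i);
  eigen_mean0 : forall i, L2_mean0 (psi i);
  eigen_orthonormal : forall i j,
    avg (fun x => psi i x * psi j x) = (i == j)%:R;
  eigen_complete : forall v, L2_mean0 v ->
    (fun n : nat => avg (fun x => (v x -
       \sum_(i < n) avg (fun y => v y * psi i y) * psi i x) ^+ 2))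
      @ \oo --> (0 : R);
  eigen_eq : forall i w gw, H1per w gw ->
    avg (fun x => dotV (appV (A x) (gpsi i x)) (gw x)) =
    lam i * avg (fun x => psi i x * w x);
  eigen_pos : 0 < lam 0%N;
  eigen_sorted : forall i j, (i <= j)%N -> lam i <= lam j }.

(* The action of div (A xi) on a function of H^1_per(Q) with gradient [gw]. *)
Definition drift A xi (gw : V -> V) : R :=
  - avg (fun x => dotV (appV (A x) xi) (gw x)).

Definition spectral_measure A (gpsi : nat -> V -> V) (lam : nat -> R) xi :
    {measure set R -> \bar R} :=
  mseries (fun i => mscale (NngNum (sqr_ge0 (drift A xi (gpsi i))))
                           (dirac (lam i))) 0.

Definition spectral_den (k : nat) (mu l : R) : R :=
  \prod_(i < k) (2 ^+ i * mu + l) ^+ 2.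

Definition spectral_P (k : nat) (mu l : R) : R :=
  l^-1 * (spectral_den k mu l - 2 ^+ (k * k.-1) * mu ^+ (2 * k)).

(* [M] is the symmetric matrix A_{mu,k}. *)
Definition homogenized_approx A (gpsi : nat -> V -> V) (lam : nat -> R)
    (mu : R) (k : nat) (M : 'M[R]_d) :=
  M^T = M /\
  forall xi, dotV xi (appV M xi) =
    avg (fun x => dotV xi (appV (A x) xi)) -
    \int[spectral_measure A gpsi lam xi]_(l in `]0, +oo[)
       (spectral_P k mu l / spectral_den k mu l).

End homogenization.

(* Main.v *)
Require Import Defs.
From HB Require Import structures.
From mathcomp Require Import all_boot all_order all_algebra.
From mathcomp Require Import ring lra zify.
From mathcomp Require Import all_classical all_reals all_analysis.
From mathcomp Require Import measurable_realfun.

Set Implicit Arguments.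
Unset Strict Implicit.
Unset Printing Implicit Defensive.
Import Order.TTheory GRing.Theory Num.Theory.
Import numFieldNormedType.Exports.
Local Open Scope classical_set_scope.
Local Open Scope ring_scope.

(** Let [p_i(m)] be the coefficient of the corrector [phi_m] on the
    eigenfunction [psi_i] and [d_i] that of the drift.  Testing the corrector
    equation with [psi_i] gives [p_i(m) = d_i / (m + lambda_i)], so Parseval's
    identity turns every [<phi_m phi_m'>] into
    [sum_i d_i^2 / ((m + lambda_i) (m' + lambda_i))].  The energy needs
    [sum_i lambda_i p_i^2 = <grad phi . A grad phi>]: the gradients of the
    residuals [phi - sum_(i<n) p_i psi_i] form a Cauchy sequence in energy, and
    they tend weakly to [0] by periodic integration by parts against smooth
    functions, which approximate the gradients themselves; so they tend to [0].
    It remains to check an identity between rational functions of [lambda].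
    The [a_{k+1,i}] are the coefficients of the partial fraction expansion of
    [mu^k / prod_(i<=k) (2^i mu + lambda)], and their sum vanishes, which makes
    the first-order poles cancel when that expansion is squared. *)

(** * Partial fractions and the recursive coefficients *)

(** Squaring a partial fraction expansion gives a sum over all pairs, whereas the [nu] sums run over
    [i < j] only; symmetry accounts for the factor 2. *)
Lemma sum_sym_triangle (R : comNzRingType) (n : nat) (F : nat -> nat -> R) :
  (forall i j, F i j = F j i) ->
  \sum_(0 <= i < n) \sum_(0 <= j < n) F i j =
  \sum_(0 <= i < n) F i i +
  \sum_(0 <= i < n) \sum_(i.+1 <= j < n) F i j *+ 2.
Proof.
move=> Fsym; elim: n => [|n IH]; first by rewrite !big_nil addr0.
rewrite big_nat_recr//= [in LHS]big_nat_recr//=.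
under eq_bigr do rewrite big_nat_recr//=.
rewrite big_split/= IH [in RHS]big_nat_recr//=.
rewrite [X in _ = _ + X]big_nat_recr//= [X in _ = _ + (_ + X)]big_geq// addr0.
rewrite [X in _ = _ + X](eq_big_nat _ _ (F2 := fun i =>
  \sum_(i.+1 <= j < n) F i j *+ 2 + F i n *+ 2)); last first.
  by move=> i /andP[_ ilt]; rewrite big_nat_recr.
rewrite [X in _ = _ + X]big_split/= [X in _ = _ + (_ + X)]sumrMnl.
rewrite [X in _ + (X + _)](eq_bigr (fun i => F i n)) => [|i _]; last exact: Fsym.
ring.
Qed.

Section coefficients.
Context (R : realType) (c : nat -> R) (a : nat -> nat -> R).
Context (c1 : c 1%N = 1)
    (cS : forall k : nat, (1 <= k)%N -> c k.+1 = (2 / c k + 1)^-1)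
    (a10 : a 1%N 0%N = 1)
    (aS0 : forall k : nat, (1 <= k)%N -> a k.+1 0%N = c k * a k 0%N)
    (aSi : forall k i : nat, (1 <= k)%N -> (1 <= i <= k - 1)%N ->
       a k.+1 i = c k * a k i - 2 ^ (1 - k%:Z) * c k * a k (i - 1)%N)
    (aSk : forall k : nat, (1 <= k)%N ->
       a k.+1 k = - 2 ^ (1 - k%:Z) * c k * a k (k - 1)%N).

Lemma pow2B1_gt0 n : 0 < 2 ^+ n.+1 - 1 :> R.
Proof. by rewrite subr_gt0 exprn_egt1// ltr1n. Qed.

(** The recursion says that [(c k)^-1 + 1] doubles at each step, starting from 2. *)
Lemma c_closed_form n : c n.+1 = (2 ^+ n.+1 - 1)^-1.
Proof.
elim: n => [|n IH].
  by rewrite c1 expr1 (_ : 2 - 1 = 1 :> R) ?invr1//; ring.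
rewrite cS// IH invrK; congr (_^-1); rewrite [2 ^+ n.+2]exprS; ring.
Qed.

(** The three cases of the recursion for [a] are one: up to the factor [c n.+1], the new row is the
    old row minus [(2 ^+ n)^-1] times its shift by one place. Pairing with a weight moves the shift
    onto [w]. *)
Lemma sum_a_rec n (w : nat -> R) :
  \sum_(0 <= i < n.+2) a n.+2 i * w i =
  c n.+1 * (\sum_(0 <= i < n.+1) a n.+1 i * w i -
            (2 ^+ n)^-1 * \sum_(0 <= i < n.+1) a n.+1 i * w i.+1).
Proof.
have e2 : (2 : R) ^ (1 - n.+1%:Z) = (2 ^+ n)^-1.
  by rewrite (_ : 1 - n.+1%:Z = - n%:Z)%R ?exprnN//; lia.
rewrite big_nat_recl//= big_nat_recr//= aS0// aSk// e2 subn1/=.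
rewrite (eq_big_nat _ _ (F2 := fun i => c n.+1 * (a n.+1 i.+1 * w i.+1) -
   (2 ^+ n)^-1 * c n.+1 * (a n.+1 i * w i.+1))); last first.
  by move=> i /andP[_ ilt]; rewrite aSi ?e2 ?subn1//=; ring.
rewrite [X in c n.+1 * (X - _)]big_nat_recl//=.
rewrite [X in c n.+1 * (_ - _ * X)]big_nat_recr//=.
rewrite sumrB -!mulr_sumr; ring.
Qed.

(** A constant weight does not see the shift, so each row sum is a multiple of the previous one. The
    factor [1 - (2 ^+ m)^-1] vanishes at [m = 0], which kills the second row sum and then all later
    ones. *)
Lemma sum_a_eq0 n : \sum_(0 <= i < n.+2) a n.+2 i = 0.
Proof.
have H m : \sum_(0 <= i < m.+2) a m.+2 i =
    c m.+1 * (1 - (2 ^+ m)^-1) * \sum_(0 <= i < m.+1) a m.+1 i.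
  have := sum_a_rec m (fun=> 1); under eq_bigr do rewrite mulr1.
  move=> ->; under eq_bigr do rewrite mulr1; ring.
elim: n => [|n IH]; last by rewrite H IH mulr0.
by rewrite H expr0 invr1 subrr mulr0 mul0r.
Qed.

Lemma pow2D_gt0 (mu l : R) i : 0 < mu -> 0 < l -> 0 < 2 ^+ i * mu + l.
Proof. by move=> m0 l0; rewrite addr_gt0// mulr_gt0// exprn_gt0. Qed.

(** Shifting the index in [(2 ^+ i * mu + l)^-1] replaces [mu] by [2 * mu], so the induction runs
    over all [mu]. The products for [mu] and [2 * mu] differ only in one end factor each;
    subtracting their inverses produces the numerator [(2 ^+ n.+1 - 1) * mu], whose constant is
    cancelled by [c n.+1]. *)
Lemma a_partial_fractions n (mu l : R) : 0 < mu -> 0 < l ->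
  \sum_(0 <= i < n.+1) a n.+1 i * (2 ^+ i * mu + l)^-1 =
  mu ^+ n / \prod_(i < n.+1) (2 ^+ i * mu + l).
Proof.
elim: n mu => [|n IH] mu mu0 l0.
  by rewrite big_nat1 big_ord1 a10 expr0 mul1r.
rewrite sum_a_rec IH//.
rewrite [X in _ - _ * X](eq_bigr
  (fun i => a n.+1 i * (2 ^+ i * (2 * mu) + l)^-1)); last first.
  by move=> i _; rewrite exprSr mulrA.
rewrite IH ?mulr_gt0// c_closed_form.
set p := \prod_(i < n) (2 ^+ i.+1 * mu + l).
have -> : \prod_(i < n.+1) (2 ^+ i * mu + l) = (mu + l) * p.
  by rewrite big_ord_recl/= mul1r.
have -> : \prod_(i < n.+1) (2 ^+ i * (2 * mu) + l) = p * (2 ^+ n.+1 * mu + l).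
  rewrite big_ord_recr/= exprSr mulrA; congr (_ * _).
  by apply: eq_bigr => i _; rewrite exprSr mulrA.
have -> : \prod_(i < n.+2) (2 ^+ i * mu + l) = (mu + l) * p * (2 ^+ n.+1 * mu + l).
  by rewrite big_ord_recl big_ord_recr/= mul1r mulrA.
have p0 : p != 0 by rewrite gt_eqF// prodr_gt0// => i _; exact: pow2D_gt0.
have q0 := pow2B1_gt0 n.
have r0 : 2 ^+ n != 0 :> R by rewrite expf_neq0.
have s0 : mu + l != 0 by rewrite gt_eqF// addr_gt0.
have t0 : 2 ^+ n.+1 * mu + l != 0 by rewrite gt_eqF// pow2D_gt0.
rewrite exprMn; move: q0 t0; rewrite exprS [mu ^+ n.+1]exprS.
move: (2 ^+ n) r0 => z z0 q0 t0.
have q0' : 2 * z - 1 != 0 by rewrite gt_eqF.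
by field; rewrite p0 q0' s0 t0 z0.
Qed.

Lemma spectral_den_gt0 k (mu l : R) : 0 < mu -> 0 < l ->
  0 < spectral_den k mu l.
Proof.
by move=> m0 l0; apply: prodr_gt0 => i _; rewrite exprn_gt0// pow2D_gt0.
Qed.

(** In the difference of consecutive ratios the numerator is [(2 ^+ n.+1 * mu + l) ^+ 2 - (2 ^+ n.+1
    * mu) ^+ 2], that is [l * (2 ^+ n.+2 * mu + l)], so [l^-1] cancels. What remains contains
    [mu ^+ (2 * n.+1)] over a product of squares: the square of the partial fraction expansion. *)
Lemma spectral_ratio_rec n (mu l : R) : 0 < mu -> 0 < l ->
  spectral_P n.+2 mu l / spectral_den n.+2 mu l =
  spectral_P n.+1 mu l / spectral_den n.+1 mu l +
  2 ^+ (n.+1 * n) * (2 ^+ n.+2 * mu + l) *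
    (\sum_(0 <= i < n.+2) a n.+2 i * (2 ^+ i * mu + l)^-1) ^+ 2.
Proof.
move=> m0 l0; rewrite a_partial_fractions// /spectral_P !succnK.
have D0 := spectral_den_gt0 n.+1 m0 l0.
have t0 : 2 ^+ n.+1 * mu + l != 0 by rewrite gt_eqF// pow2D_gt0.
have -> : spectral_den n.+2 mu l =
    spectral_den n.+1 mu l * (2 ^+ n.+1 * mu + l) ^+ 2.
  by rewrite /spectral_den big_ord_recr.
rewrite expr_div_n -prodrXl big_ord_recr/=.
rewrite -/(spectral_den n.+1 mu l).
move: (spectral_den n.+1 mu l) D0 => D D0.
have -> : 2 ^+ (n.+2 * n.+1) = 2 ^+ (n.+1 * n) * (2 ^+ n.+1) ^+ 2 :> R.
  by rewrite -exprM -exprD; congr (_ ^+ _); lia.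
have -> : mu ^+ (2 * n.+2) = mu ^+ (2 * n.+1) * mu ^+ 2.
  by rewrite -exprD; congr (_ ^+ _); lia.
rewrite -[(mu ^+ n.+1) ^+ 2]exprM [(n.+1 * 2)%N]mulnC [2 ^+ n.+2]exprS.
move: (2 ^+ n.+1) (2 ^+ (n.+1 * n)) (mu ^+ (2 * n.+1)) t0 => z y x t0.
by field; rewrite t0 !gt_eqF.
Qed.

(** Positivity allows integration term by term against the spectral measure. The first ratio is
    explicit and each step of the recursion adds a nonnegative term. *)
Lemma spectral_ratio_ge0 n (mu l : R) : 0 < mu -> 0 < l ->
  0 <= spectral_P n.+1 mu l / spectral_den n.+1 mu l.
Proof.
move=> m0 l0; elim: n => [|n IH].
  have -> : spectral_P 1 mu l / spectral_den 1 mu l = (2 * mu + l) / (mu + l) ^+ 2.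
    rewrite /spectral_P /spectral_den big_ord1 expr0 mul1r.
    by field; rewrite !gt_eqF// addr_gt0.
  by rewrite divr_ge0 ?sqr_ge0// addr_ge0 ?mulr_ge0 ?ltW.
rewrite spectral_ratio_rec// addr_ge0// mulr_ge0 ?sqr_ge0// mulr_ge0 ?exprn_ge0//.
by rewrite ltW// pow2D_gt0.
Qed.

(** * The form with coefficients [eta] and [nu] *)

Context (eta : nat -> nat -> R) (nu : nat -> nat -> nat -> R).
Context (eta10 : eta 1%N 0%N = 0)
    (etaSi : forall k i : nat, (1 <= k)%N -> (i <= k - 1)%N ->
       eta k.+1 i = eta k i +
         (2 ^+ (k * (k - 1) + i) - 2 ^+ (k ^ 2 + 1)) * a k.+1 i ^+ 2)
    (etaSk : forall k : nat, (1 <= k)%N ->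
       eta k.+1 k = - 2 ^+ (k ^ 2) * a k.+1 k ^+ 2)
    (nuSk : forall k i : nat, (1 <= k)%N -> (i <= k - 1)%N ->
       nu k.+1 i k =
         (2 ^+ (k * (k - 1) + i) - 3 * 2 ^+ (k ^ 2)) * a k.+1 i * a k.+1 k)
    (nuSij : forall k i j : nat, (1 <= k)%N -> (i < j <= k - 1)%N ->
       nu k.+1 i j = nu k i j +
         (2 ^+ (k * (k - 1)) * (2 ^+ i + 2 ^+ j) - 2 ^+ (k ^ 2 + 2)) *
         a k.+1 i * a k.+1 j).

(** The array [w] is left free because the form is evaluated both at the products of resolvent
    factors [(2 ^+ i * mu + l)^-1] and at the inner products of correctors; linearity in [w] links
    the two. *)
Definition corrector_form k (w : nat -> nat -> R) : R :=
  \sum_(0 <= i < k) eta k i * w i i +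
  \sum_(0 <= i < k) \sum_(i.+1 <= j < k) nu k i j * w i j.

Lemma corrector_form_sum k (I : Type) (s : seq I) (W : I -> nat -> nat -> R) :
  \sum_(l <- s) corrector_form k (W l) =
  corrector_form k (fun i j => \sum_(l <- s) W l i j).
Proof.
rewrite /corrector_form big_split/=; congr (_ + _).
  by rewrite exchange_big; apply: eq_bigr => i _; rewrite mulr_sumr.
rewrite exchange_big; apply: eq_bigr => i _; rewrite exchange_big.
by apply: eq_bigr => j _; rewrite mulr_sumr.
Qed.

Lemma corrector_formZ k (x : R) (w : nat -> nat -> R) :
  corrector_form k (fun i j => x * w i j) = x * corrector_form k w.
Proof.
rewrite /corrector_form mulrDr !mulr_sumr; congr (_ + _).
  by apply: eq_bigr => i _; rewrite mulrCA.
by apply: eq_bigr => i _; rewrite mulr_sumr; apply: eq_bigr => j _; rewrite mulrCA.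
Qed.

(** The four recursions for [eta] and [nu] are one: the increments are, up to the factor
    [- 2 ^+ (n.+1 * n)], the diagonal entries and the doubled off-diagonal entries of a single
    symmetric kernel. *)
Lemma corrector_form_rec n (w : nat -> nat -> R) :
  (forall i j, w i j = w j i) ->
  corrector_form n.+2 w = corrector_form n.+1 w -
  2 ^+ (n.+1 * n) * \sum_(0 <= i < n.+2) \sum_(0 <= j < n.+2)
    (2 ^+ n.+2 - (2 ^+ i + 2 ^+ j) / 2) * (a n.+2 i * a n.+2 j) * w i j.
Proof.
move=> wsym; pose B : R := 2 ^+ (n.+1 * n).
have e1 : 2 ^+ (n.+1 ^ 2) = B * 2 ^+ n.+1 :> R.
  by rewrite /B -exprD; congr (_ ^+ _); lia.
rewrite sum_sym_triangle; last first.
  by move=> i j; rewrite [2 ^+ i + _]addrC [a _ i * _]mulrC wsym.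
rewrite /corrector_form.
pose F i j := (2 ^+ n.+2 - (2 ^+ i + 2 ^+ j) / 2) * (a n.+2 i * a n.+2 j) * w i j.
have -> : \sum_(0 <= i < n.+2) eta n.+2 i * w i i =
    \sum_(0 <= i < n.+1) eta n.+1 i * w i i - B * \sum_(0 <= i < n.+2) F i i.
  rewrite big_nat_recr//= [X in B * X]big_nat_recr//= etaSk// e1.
  rewrite (eq_big_nat _ _ (F2 := fun i => eta n.+1 i * w i i - B * F i i)).
    by rewrite sumrB -mulr_sumr /F [2 ^+ n.+2]exprS; field.
  move=> i /andP[_ ilt]; rewrite etaSi ?subn1//= exprD -/B.
  by rewrite (exprD _ (n.+1 ^ 2)) e1 expr1 /F [2 ^+ n.+2]exprS; field.
have -> : \sum_(0 <= i < n.+2) \sum_(i.+1 <= j < n.+2) nu n.+2 i j * w i j =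
    \sum_(0 <= i < n.+1) \sum_(i.+1 <= j < n.+1) nu n.+1 i j * w i j -
    B * \sum_(0 <= i < n.+2) \sum_(i.+1 <= j < n.+2) F i j *+ 2.
  rewrite big_nat_recr//= [X in _ + X]big_geq// addr0.
  rewrite [X in B * X]big_nat_recr//= [X in _ - B * (_ + X)]big_geq// addr0.
  rewrite mulr_sumr -sumrB; apply: eq_big_nat => i /andP[_ ilt].
  rewrite big_nat_recr// [X in B * X]big_nat_recr//= nuSk ?subn1//= exprD -/B e1.
  rewrite mulrDr opprD addrA; congr (_ + _).
    rewrite mulr_sumr -sumrB; apply: eq_big_nat => j /andP[ij jlt].
    rewrite nuSij ?subn1//= ?ij//= -/B (exprD _ (n.+1 ^ 2)) e1 /F !exprS expr0.
    by field.
  by rewrite /F [2 ^+ n.+2]exprS; field.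
rewrite /F -/B; ring.
Qed.

(** The first term is the spectral density of the energy defect of the corrector at [mu], the second
    that of the products of correctors. By induction, it suffices to match the increments of the two
    recursions. *)
Lemma spectral_ratio_expansion n (mu l : R) : 0 < mu -> 0 < l ->
  spectral_P n.+1 mu l / spectral_den n.+1 mu l =
  (2 * mu + l) / (mu + l) ^+ 2 -
  mu * corrector_form n.+1 (fun i j =>
    (2 ^+ i * mu + l)^-1 * (2 ^+ j * mu + l)^-1).
Proof.
move=> m0 l0; pose u i := (2 ^+ i * mu + l)^-1.
rewrite -/(fun i j => u i * u j); elim: n => [|n IH].
  rewrite /corrector_form !big_nat1 eta10 mul0r big_geq// addr0 mulr0 subr0.
  rewrite /spectral_P /spectral_den big_ord1 expr0 mul1r.
  by field; rewrite !gt_eqF// addr_gt0.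
rewrite spectral_ratio_rec// IH corrector_form_rec; last first.
  by move=> i j; rewrite mulrC.
set S := \sum_(0 <= i < n.+2) a n.+2 i * _.
pose T := \sum_(0 <= i < n.+2) a n.+2 i.
(* The kernel equals [2 ^+ n.+2 + l / mu] minus [((2 ^+ i * mu + l) + (2 ^+ j * mu + l)) / (2 *
   mu)]. Each of the last two summands cancels one denominator and leaves a factor [T], which is
   zero. *)
rewrite (eq_bigr (fun i => \sum_(0 <= j < n.+2)
   ((2 ^+ n.+2 + l / mu) * ((a n.+2 i * u i) * (a n.+2 j * u j)) -
    (2 * mu)^-1 * ((a n.+2 i * u i) * a n.+2 j) -
    (2 * mu)^-1 * (a n.+2 i * (a n.+2 j * u j))))); last first.
  move=> i _; apply: eq_bigr => j _; rewrite /u.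
  have := pow2D_gt0 i m0 l0; have := pow2D_gt0 j m0 l0.
  move: (2 ^+ i) (2 ^+ j) (a _ i) (a _ j) => ui uj ai aj p q.
  by field; rewrite !gt_eqF.
have -> : \sum_(0 <= i < n.+2) \sum_(0 <= j < n.+2)
   ((2 ^+ n.+2 + l / mu) * ((a n.+2 i * u i) * (a n.+2 j * u j)) -
    (2 * mu)^-1 * ((a n.+2 i * u i) * a n.+2 j) -
    (2 * mu)^-1 * (a n.+2 i * (a n.+2 j * u j))) =
   (2 ^+ n.+2 + l / mu) * S ^+ 2 - (2 * mu)^-1 * (S * T) - (2 * mu)^-1 * (T * S).
  under eq_bigr do rewrite !sumrB -!mulr_sumr.
  rewrite !sumrB -!mulr_sumr -!mulr_suml.
  by rewrite -[\sum_(0 <= i < n.+2) a n.+2 i * u i]/S -/T; ring.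
rewrite /T sum_a_eq0; move: S (corrector_form _ _) => S K.
by field; rewrite !gt_eqF// addr_gt0.
Qed.

End coefficients.

(** * Lebesgue measure on the cube and periodic functions *)

Section measure_on_rV.
Context (R : realType).

Definition boxV n (p q : 'I_n -> R) : set 'rV[R]_n :=
  [set x | forall i, p i < x ord0 i < q i].

Lemma measurable_boxV n (p q : 'I_n -> R) : measurable (boxV p q).
Proof.
have -> : boxV p q = \bigcap_(i in [set: 'I_n])
    ((fun x : 'rV[R]_n => x ord0 i) @^-1` [set` `]p i, q i[]).
  by apply/seteqP; split=> x /= H i => [_|]; have := H i; rewrite /= in_itv//=; apply.
apply: fin_bigcap_measurable => [|i _]; first exact: finite_finset.
by rewrite -[X in measurable X]setTI; exact: measurable_coord.
Qed.

Lemma measurable_cube n : measurable (@cube R n).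
Proof. exact: (@measurable_boxV n (fun=> 0) (fun=> 1)). Qed.

(** The sigma-algebra is generated by the coordinates, not by the topology. An open set is the union
    of the rational boxes that it contains, and these are countably many. *)
Lemma measurable_open_rV n (U : set 'rV[R]_n) : open U -> measurable U.
Proof.
move=> oU.
pose B (pq : 'rV[rat]_n * 'rV[rat]_n) :=
  boxV (fun i => ratr (pq.1 ord0 i) : R) (fun i => ratr (pq.2 ord0 i)).
pose F pq := if `[< B pq `<=` U >] then B pq else set0.
have -> : U = \bigcup_pq F pq.
  apply/seteqP; split=> [x Ux|x [pq _]]; last first.
    by rewrite /F; case: asboolP => // BU; exact: BU.
  have /nbhs_ballP[e /= e0 eU] : nbhs x U by exact: open_nbhs_nbhs.
  have p i : {r : rat | ratr r \in `]x ord0 i - e, x ord0 i[}.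
    by apply: cid; apply: rat_in_itvoo; rewrite ltrBlDr ltrDl.
  have q i : {r : rat | ratr r \in `]x ord0 i, x ord0 i + e[}.
    by apply: cid; apply: rat_in_itvoo; rewrite ltrDl.
  exists (\row_i sval (p i), \row_i sval (q i)) => //.
  rewrite /F asboolT.
    move=> i; rewrite !mxE/=; case: (p i) => r /=; case: (q i) => s /=.
    by rewrite !in_itv/= => /andP[? _] /andP[_ ?]; apply/andP.
  move=> y By; apply: eU; split => // i j; rewrite (ord1 i) /ball/=.
  have := By j; rewrite !mxE/=; case: (p j) => r /=; case: (q j) => s /=.
  rewrite !in_itv/= => /andP[? ?] /andP[? ?] /andP[? ?].
  by rewrite ltr_norml; apply/andP; split; lra.
apply: countable_bigcupT_measurable => [|pq]; first exact: countableP.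
by rewrite /F; case: asboolP => // _; exact: measurable_boxV.
Qed.

Lemma continuous_measurable_rV n (f : 'rV[R]_n -> R) :
  continuous f -> measurable_fun [set: 'rV[R]_n] f.
Proof.
move=> /continuousP cf.
apply: (measurability _ (RGenOInfty.measurableE R)) => _ [_ [a ->] <-].
rewrite setTI; apply: measurable_open_rV; apply: cf; exact: interval_open.
Qed.

Lemma cons_rV_preimage_cube n :
  @cons_rV R n @^-1` (@cube R n.+1) = `]0%R, 1%R[%classic `*` @cube R n.
Proof.
apply/seteqP; split=> [[t y]|[t y] [/= t01 y01] i].
  move=> H; split=> /=; first by have := H ord0; rewrite mxE unlift_none/= in_itv.
  by move=> j; have := H (lift ord0 j); rewrite mxE liftK.
rewrite mxE; case: unliftP => [j _|_] /=; first exact: y01.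
by rewrite in_itv in t01.
Qed.

Lemma lebesgue_rV_cube n : lebesgue_rV R n (@cube R n) = 1%E.
Proof.
elim: n => [|n IH].
  by rewrite /= /dirac/= indicE mem_set//= => -[].
rewrite /= /lebesgue_rV_step /pushforward cons_rV_preimage_cube.
rewrite [LHS]product_measure1E//; last exact: measurable_cube.
rewrite IH mule1; apply: etrans (lebesgue_measure_itv `]0%R, 1%R[) _.
by rewrite /= lte_fin ltr01 EFinN oppe0 adde0.
Qed.

Lemma lebesgue_rV_cube_lty n : (lebesgue_rV R n (@cube R n) < +oo)%E.
Proof. by rewrite lebesgue_rV_cube ltry. Qed.

(** The bound comes from the closed cube, which is compact. *)
Lemma continuous_cube_bounded n (f : 'rV[R]_n -> R) : continuous f ->
  exists M : R, forall x, cube x -> `|f x| <= M.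
Proof.
move=> cf.
have : compact (f @` [set x : 'rV[R]_n | forall i, `[0, 1]%classic (x ord0 i)]).
  apply: continuous_compact; first exact: continuous_subspaceT.
  exact: (@rV_compact R n (fun=> `[0, 1]%classic) (fun=> @segment_compact R 0 1)).
move=> /compact_bounded[M [_ Mf]]; exists (M + 1) => x x01.
have M1 : M < M + 1 by rewrite ltrDl.
apply: (Mf _ M1 (f x)).
by exists x => // i; rewrite /= in_itv/=; have /andP[/ltW -> /ltW ->] := x01 i.
Qed.

Lemma continuous_cube_integrable n (f : 'rV[R]_n -> R) : continuous f ->
  (lebesgue_rV R n).-integrable (@cube R n) (EFin \o f).
Proof.
move=> cf; apply: measurable_bounded_integrable.
- exact: measurable_cube.
- exact: lebesgue_rV_cube_lty.
- by apply: measurable_funTS; exact: continuous_measurable_rV.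
- have [M fM] := continuous_cube_bounded cf.
  by exists M; split; [exact: num_real|move=> K /ltW MK x /fM /le_trans; exact].
Qed.

Lemma continuous_cons_rV1 n (y : 'rV[R]_n) :
  continuous (fun t : R => cons_rV (t : measurableTypeR R, y)).
Proof.
move=> t s /nbhs_ballP[e /= e0 es]; apply/nbhs_ballP; exists e => //= u tu.
apply: es; split=> // i j; rewrite !mxE.
by case: unliftP => [k _|_] //; exact: ballxx.
Qed.

Lemma continuous_cons_rV2 n (t : R) :
  continuous (fun y : 'rV[R]_n => cons_rV (t : measurableTypeR R, y)).
Proof.
move=> y s /nbhs_ballP[e /= e0 es]; apply/nbhs_ballP; exists e => //= z [_ yz].
apply: es; split=> // i j; rewrite !mxE.
by case: unliftP => [k _|_]; [exact: yz|exact: ballxx].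
Qed.

Lemma continuous_cons_integrable n (f : 'rV[R]_n.+1 -> R) : continuous f ->
  (@lebesgue_measure R \x lebesgue_rV R n)%E.-integrable
    (`]0%R, 1%R[%classic `*` @cube R n) (fun z => (f (cons_rV z))%:E).
Proof.
move=> cf; apply: (measurable_bounded_integrable (f := f \o @cons_rV R n)).
- by apply: measurableX => //; exact: measurable_cube.
- have := lebesgue_rV_cube_lty n.+1.
  by rewrite /= /lebesgue_rV_step /pushforward cons_rV_preimage_cube.
- apply: measurable_funTS; apply: measurableT_comp (@measurable_cons_rV R n).
  exact: continuous_measurable_rV.
- have [M fM] := continuous_cube_bounded cf.
  exists M; split; [exact: num_real|move=> K /ltW MK z].
  rewrite -cons_rV_preimage_cube => /fM /le_trans; exact.
Qed.

Lemma integral_cube_cons n (f : 'rV[R]_n.+1 -> R) : continuous f ->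
  (\int[lebesgue_rV R n.+1]_(x in @cube R n.+1) (f x)%:E =
   \int[@lebesgue_measure R \x lebesgue_rV R n]_(z in
     `]0%R, 1%R[%classic `*` @cube R n) (f (cons_rV z))%:E)%E.
Proof.
move=> cf; rewrite -cons_rV_preimage_cube.
apply: (integral_pushforward (@measurable_cons_rV R n) (f := EFin \o f)).
- by apply/measurable_EFinP; exact: continuous_measurable_rV.
- by rewrite cons_rV_preimage_cube; exact: continuous_cons_integrable.
- exact: measurable_cube.
Qed.

(** Extension by zero, so that Fubini can be applied on the whole product space. *)
Let fcut n (f : 'rV[R]_n.+1 -> R) : measurableTypeR R * 'rV[R]_n -> \bar R :=
  (fun z => (f (cons_rV z))%:E) \_ (`]0%R, 1%R[%classic `*` @cube R n).

Let fcut_integrable n (f : 'rV[R]_n.+1 -> R) : continuous f ->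
  (@lebesgue_measure R \x lebesgue_rV R n)%E.-integrable setT (fcut f).
Proof.
move=> cf; apply: (integrable_mkcond _ _).1; last exact: continuous_cons_integrable.
by apply: measurableX => //; exact: measurable_cube.
Qed.

Let fcutE n (f : 'rV[R]_n.+1 -> R) t y : fcut f (t, y) =
  if (t \in `]0%R, 1%R[) && (y \in @cube R n) then (f (cons_rV (t, y)))%:E else 0%E.
Proof. by rewrite /fcut patchE in_setX mem_setE. Qed.

(** Both orders of integration are needed: this one leaves slices of lower dimension to an
    induction, the other puts the first coordinate innermost, for the fundamental theorem of
    calculus. *)
Lemma integral_cube_fubini1 n (f : 'rV[R]_n.+1 -> R) : continuous f ->
  (\int[lebesgue_rV R n.+1]_(x in @cube R n.+1) (f x)%:E =
   \int[@lebesgue_measure R]_(t in `]0%R, 1%R[)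
     \int[lebesgue_rV R n]_(y in @cube R n)
       (f (cons_rV (t : measurableTypeR R, y)))%:E)%E.
Proof.
move=> cf; rewrite integral_cube_cons// integral_mkcond -/(fcut f).
rewrite -(integral12_prod_meas1 (fcut_integrable cf)) [RHS]integral_mkcond.
apply: eq_integral => t _; rewrite /fubini_F patchE mem_setE.
case: ifPn => t01.
  rewrite [RHS]integral_mkcond; apply: eq_integral => y _.
  by rewrite fcutE t01/= patchE.
rewrite -[RHS](integral0 (lebesgue_rV R n) setT).
by apply: eq_integral => y _; rewrite fcutE (negbTE t01).
Qed.

Lemma integral_cube_fubini2 n (f : 'rV[R]_n.+1 -> R) : continuous f ->
  (\int[lebesgue_rV R n.+1]_(x in @cube R n.+1) (f x)%:E =
   \int[lebesgue_rV R n]_(y in @cube R n)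
     \int[@lebesgue_measure R]_(t in `]0%R, 1%R[)
       (f (cons_rV (t : measurableTypeR R, y)))%:E)%E.
Proof.
move=> cf; rewrite integral_cube_cons// integral_mkcond -/(fcut f).
rewrite -(integral21_prod_meas1 (fcut_integrable cf)) [RHS]integral_mkcond.
apply: eq_integral => y _; rewrite /fubini_G patchE.
case: ifPn => y01.
  rewrite [RHS]integral_mkcond; apply: eq_integral => t _.
  by rewrite fcutE y01 andbT patchE mem_setE.
rewrite -[RHS](integral0 (@lebesgue_measure R) setT).
by apply: eq_integral => t _; rewrite fcutE (negbTE y01) andbF.
Qed.

(** * Partial derivatives on slices and integrals of periodic derivatives *)

Lemma cons_rV_shift1 n (h t : R) (y : 'rV[R]_n) :
  cons_rV (h *: 1 + t : measurableTypeR R, y) =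
  h *: baseV R ord0 + cons_rV (t : measurableTypeR R, y).
Proof.
apply/rowP => i; rewrite !mxE eqxx/=.
case: unliftP => [j ->|->]; first by rewrite eq_sym (negbTE (neq_lift _ _)) mulr0 add0r.
by rewrite eqxx.
Qed.

Lemma cons_rV_shift2 n (h t : R) (y : 'rV[R]_n) j :
  cons_rV (t : measurableTypeR R, h *: baseV R j + y) =
  h *: baseV R (lift ord0 j) + cons_rV (t : measurableTypeR R, y).
Proof.
apply/rowP => i; rewrite !mxE eqxx/=.
case: unliftP => [k ->|->]; last by rewrite (negbTE (neq_lift _ _)) mulr0 add0r.
by rewrite !mxE eqxx/= (inj_eq lift_inj).
Qed.

(** Freezing the other coordinates leaves the difference quotient unchanged as a function of [h], so
    derivability and the value of the derivative both transfer. *)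
Let quotient_cons1 n (F : 'rV[R]_n.+1 -> R) (t : measurableTypeR R) y :
  (fun h : R => h^-1 *: (((fun s : R => F (cons_rV (s : measurableTypeR R, y)))
    \o shift (t : R)) (h *: 1) - F (cons_rV (t, y)))) =
  (fun h : R => h^-1 *: ((F \o shift (cons_rV (t, y))) (h *: baseV R ord0) -
    F (cons_rV (t, y)))).
Proof. by apply/funext => h; rewrite /= cons_rV_shift1. Qed.

Lemma derivable_cons1 n (F : 'rV[R]_n.+1 -> R) (t : measurableTypeR R) y :
  derivable F (cons_rV (t, y)) (baseV R ord0) ->
  derivable (fun s : R => F (cons_rV (s : measurableTypeR R, y))) t 1.
Proof. by rewrite /derivable quotient_cons1. Qed.

Lemma derive_cons1 n (F : 'rV[R]_n.+1 -> R) (t : measurableTypeR R) y :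
  'D_1 (fun s : R => F (cons_rV (s : measurableTypeR R, y))) t =
  'D_(baseV R ord0) F (cons_rV (t, y)).
Proof. by rewrite /derive quotient_cons1. Qed.

Let quotient_cons2 n (F : 'rV[R]_n.+1 -> R) (t : measurableTypeR R) y j :
  (fun h : R => h^-1 *: (((fun z => F (cons_rV (t, z)))
    \o shift y) (h *: baseV R j) - F (cons_rV (t, y)))) =
  (fun h : R => h^-1 *: ((F \o shift (cons_rV (t, y)))
     (h *: baseV R (lift ord0 j)) - F (cons_rV (t, y)))).
Proof. by apply/funext => h; rewrite /= cons_rV_shift2. Qed.

Lemma derivable_cons2 n (F : 'rV[R]_n.+1 -> R) (t : measurableTypeR R) y j :
  derivable F (cons_rV (t, y)) (baseV R (lift ord0 j)) ->
  derivable (fun z => F (cons_rV (t, z))) y (baseV R j).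
Proof. by rewrite /derivable quotient_cons2. Qed.

Lemma derive_cons2 n (F : 'rV[R]_n.+1 -> R) (t : measurableTypeR R) y j :
  'D_(baseV R j) (fun z => F (cons_rV (t, z))) y =
  'D_(baseV R (lift ord0 j)) F (cons_rV (t, y)).
Proof. by rewrite /derive quotient_cons2. Qed.

(** Induction on the dimension. If [i] is not the first direction, each slice with frozen first
    coordinate has integral zero by induction. If it is, the inner integral is a difference of
    boundary values, which agree by periodicity. *)
Lemma integral_derive_periodic n (F : 'rV[R]_n -> R) (i : 'I_n) :
  continuous F -> (forall x, derivable F x (baseV R i)) ->
  continuous (fun x => 'D_(baseV R i) F x) ->
  (forall x, F (x + baseV R i) = F x) ->
  (\int[lebesgue_rV R n]_(x in @cube R n) ('D_(baseV R i) F x)%:E = 0)%E.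
Proof.
elim: n F i => [|n IH] F i cF dF cdF pF; first by case: i {dF cdF pF}.
case: (unliftP ord0 i) => [j ij|i0].
  rewrite integral_cube_fubini1//.
  rewrite -[RHS](integral0 (@lebesgue_measure R) `]0%R, 1%R[%classic).
  apply: eq_integral => t _.
  rewrite -(IH (fun z => F (cons_rV (t : measurableTypeR R, z))) j).
  - by apply: eq_integral => y _; rewrite derive_cons2 ij.
  - by move=> y; exact: (continuous_comp (@continuous_cons_rV2 n t y) (cF _)).
  - by move=> y; apply: derivable_cons2; rewrite -ij.
  - under eq_fun do rewrite derive_cons2 -ij.
    by move=> y; exact: (continuous_comp (@continuous_cons_rV2 n t y) (cdF _)).
  - move=> y; rewrite -[RHS]pF ij; congr F.
    by have := cons_rV_shift2 1 t y j; rewrite !scale1r addrC [RHS]addrC.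
rewrite integral_cube_fubini2//.
rewrite -[RHS](integral0 (lebesgue_rV R n) (@cube R n)).
apply: eq_integral => y _.
pose f t := 'D_(baseV R i) F (cons_rV (t : measurableTypeR R, y)).
pose G t := F (cons_rV (t : measurableTypeR R, y)).
have cf : continuous (f : R -> R).
  by move=> t; exact: (continuous_comp (@continuous_cons_rV1 n y t) (cdF _)).
have cG : continuous (G : R -> R).
  by move=> t; exact: (continuous_comp (@continuous_cons_rV1 n y t) (cF _)).
(* Adding the two endpoints, a null set, gives the closed interval of the fundamental theorem. *)
rewrite -(integral_itv_bndoo true false); last first.
  apply/measurable_EFinP; apply: measurable_funTS; exact: continuous_measurable_fun.
rewrite (continuous_FTC2 (F := G) (f := f) ltr01).
- rewrite /G -EFinB; apply/eqP; rewrite eqe subr_eq0; apply/eqP.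
  rewrite -[RHS]pF i0; congr F.
  by have := cons_rV_shift1 1 0 y; rewrite !scale1r addr0 => ->; rewrite addrC.
- exact: continuous_subspaceT.
- split; last 2 first.
  + by apply: cvg_at_right_filter; exact: cG.
  + by apply: cvg_at_left_filter; exact: cG.
  + by move=> t _; apply: derivable_cons1; rewrite -i0.
- by move=> t _; rewrite derive1E derive_cons1 -i0.
Qed.

End measure_on_rV.

(** * The space L2 of the cube *)

Section L2_theory.
Context (R : realType) (d : nat).
Notation V := 'rV[R]_d.
Notation m := (lebesgue_rV R d).
Notation Q := (@cube R d).
Implicit Types (u v w f h : V -> R) (g : V -> V).

Definition integrableQ f := m.-integrable Q (EFin \o f).

Let mQ : measurable Q := @measurable_cube R d.

Lemma integrableQD f h : integrableQ f -> integrableQ h ->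
  integrableQ (fun x => f x + h x).
Proof. by move=> fi hi; exact: (integrableD mQ fi hi). Qed.

Lemma integrableQZ c f : integrableQ f -> integrableQ (fun x => c * f x).
Proof. by move=> fi; exact: (integrableZl mQ c fi). Qed.

Lemma integrableQ_sum (I : Type) (s : seq I) (F : I -> V -> R) :
  (forall i, integrableQ (F i)) -> integrableQ (fun x => \sum_(i <- s) F i x).
Proof.
move=> Fi; elim: s => [|i s IH].
  by rewrite /integrableQ; under eq_fun do rewrite big_nil; exact: integrable0.
by rewrite /integrableQ; under eq_fun do rewrite big_cons; exact: integrableQD.
Qed.

Lemma avgD f h : integrableQ f -> integrableQ h ->
  avg (fun x => f x + h x) = avg f + avg h.
Proof. exact: RintegralD. Qed.

Lemma avgZ c f : integrableQ f -> avg (fun x => c * f x) = c * avg f.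
Proof. exact: RintegralZl. Qed.

Lemma avg_sum (I : Type) (s : seq I) (F : I -> V -> R) :
  (forall i, integrableQ (F i)) ->
  avg (fun x => \sum_(i <- s) F i x) = \sum_(i <- s) avg (F i).
Proof.
move=> Fi; elim: s => [|i s IH].
  rewrite big_nil /avg; under eq_Rintegral do rewrite big_nil.
  by rewrite Rintegral_cst// mul0r.
rewrite big_cons /avg; under eq_Rintegral do rewrite big_cons.
by rewrite [LHS]avgD// ?IH//; exact: integrableQ_sum.
Qed.

Lemma eq_avg f h : f =1 h -> avg f = avg h.
Proof. by move=> /funext ->. Qed.

Lemma ae_le_avg f h : integrableQ f -> integrableQ h ->
  {ae m, forall x, f x <= h x} -> avg f <= avg h.
Proof.
move=> fi hi fh; rewrite -subr_ge0.
have -> : avg h - avg f = avg (fun x => h x + (-1) * f x).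
  by rewrite avgD ?avgZ ?mulN1r//; exact: integrableQZ.
have di : integrableQ (fun x => h x + -1 * f x).
  by apply: integrableQD => //; exact: integrableQZ.
have [mdi _] := integrableP _ _ _ di.
(* The difference is nonnegative only almost everywhere, so it is replaced by its positive part,
   which is nonnegative everywhere. *)
rewrite /avg /Rintegral (ae_eq_integral
   (fun x => (Num.max 0 (h x + (-1) * f x))%:E) _ mQ)//.
- by apply: fine_ge0; apply: integral_ge0 => x _; rewrite lee_fin le_max lexx.
- apply/measurable_EFinP; apply: measurable_maxr => //.
  exact/measurable_EFinP.
- near=> x => _; congr EFin; apply/esym/max_idPr.
  rewrite mulN1r subr_ge0; near: x; exact: fh.
Unshelve. all: by end_near. Qed.

Lemma avg_sqr_ge0 f : 0 <= avg (fun x => f x * f x).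
Proof. by apply: Rintegral_ge0 => x _; rewrite -expr2 sqr_ge0. Qed.

Lemma L2M u v : L2 u -> L2 v -> integrableQ (fun x => u x * v x).
Proof.
move=> [mu iu] [mv iv].
apply: (le_integrable mQ _ _ (integrableD mQ iu iv)).
  by apply/measurable_EFinP; exact: measurable_funM.
move=> x _ /=; rewrite lee_fin normrM.
rewrite [leRHS]ger0_norm ?addr_ge0 ?sqr_ge0//.
rewrite -(real_normK (num_real (u x))) -(real_normK (num_real (v x))).
have := normr_ge0 (u x); have := normr_ge0 (v x).
by move: `|u x| `|v x| => a b; nra.
Qed.

Lemma L2_of_sqr u : measurable_fun Q u -> integrableQ (fun x => u x * u x) ->
  L2 u.
Proof. by move=> mu iu; split => //; under eq_fun do rewrite expr2. Qed.

Lemma L2D u v : L2 u -> L2 v -> L2 (fun x => u x + v x).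
Proof.
move=> hu hv; apply: L2_of_sqr.
  by apply: measurable_funD; [case: hu|case: hv].
under eq_fun do rewrite mulrDl !mulrDr.
by do 2![apply: integrableQD]; try apply: integrableQD; apply: L2M.
Qed.

Lemma L2_bounded_mul (b : R) h u : measurable_fun [set: V] h ->
  {ae m, forall x, `|h x| <= b} -> L2 u -> L2 (fun x => h x * u x).
Proof.
move=> mh hb hu; have [mu iu] := hu.
have mhu : measurable_fun Q (fun x => h x * u x).
  by apply: measurable_funM => //; exact: measurable_funTS.
split=> //; apply/integrableP; split.
  by apply/measurable_EFinP; exact: measurable_funX.
have i2 : integrableQ (fun x => b ^+ 2 * (u x * u x)).
  by apply: integrableQZ; exact: L2M.
have [m2 /(le_lt_trans _)] := integrableP _ _ _ i2; apply.
apply: ae_ge0_le_integral => //.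
- by apply: measurableT_comp => //; apply/measurable_EFinP; exact: measurable_funX.
- by apply: measurableT_comp.
- near=> x => _; rewrite /= lee_fin ger0_norm ?sqr_ge0//.
  rewrite -[u x * u x]expr2 [leRHS]ger0_norm; last first.
    by apply: mulr_ge0; exact: sqr_ge0.
  rewrite exprMn ler_wpM2r ?sqr_ge0//.
  rewrite -(real_normK (num_real (h x))) lerXn2r ?nnegrE//.
    by apply: le_trans (normr_ge0 (h x)) _; near: x; exact: hb.
  by near: x; exact: hb.
Unshelve. all: by end_near. Qed.

Lemma L2Z c u : L2 u -> L2 (fun x => c * u x).
Proof.
move=> hu; apply: (@L2_bounded_mul `|c| (fun=> c)) => //.
exact: aeW.
Qed.

Lemma L2B u v : L2 u -> L2 v -> L2 (fun x => u x - v x).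
Proof.
move=> hu hv; have := L2D hu (L2Z (-1) hv).
by under eq_fun do rewrite mulN1r.
Qed.

Lemma L2_continuous u : continuous u -> L2 u.
Proof.
move=> cu; apply: L2_of_sqr.
  by apply: measurable_funTS; exact: continuous_measurable_rV.
apply: continuous_cube_integrable => x; exact: (cvgM (cu x) (cu x)).
Qed.

Lemma L2_cst c : L2 (fun _ : V => c).
Proof. by apply: L2_continuous; exact: cst_continuous. Qed.

Lemma L2_sum (I : Type) (s : seq I) (F : I -> V -> R) :
  (forall i, L2 (F i)) -> L2 (fun x => \sum_(i <- s) F i x).
Proof.
move=> Fi; elim: s => [|i s IH].
  by under eq_fun do rewrite big_nil; exact: L2_cst.
by under eq_fun do rewrite big_cons; exact: L2D.
Qed.

Definition ip u v := avg (fun x => u x * v x).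

Lemma ipC u v : ip u v = ip v u.
Proof. by apply: eq_avg => x; rewrite mulrC. Qed.

Lemma ipDl u v w : L2 u -> L2 v -> L2 w ->
  ip (fun x => u x + v x) w = ip u w + ip v w.
Proof.
move=> hu hv hw; rewrite /ip; under eq_avg do rewrite mulrDl.
by rewrite avgD//; exact: L2M.
Qed.

Lemma ipZl c u w : L2 u -> L2 w -> ip (fun x => c * u x) w = c * ip u w.
Proof.
move=> hu hw; rewrite /ip; under eq_avg do rewrite -mulrA.
by rewrite avgZ//; exact: L2M.
Qed.

Lemma ipBl u v w : L2 u -> L2 v -> L2 w ->
  ip (fun x => u x - v x) w = ip u w - ip v w.
Proof.
move=> hu hv hw; rewrite -mulN1r -ipZl// -ipDl//; last exact: L2Z.
by congr ip; apply/funext => x; rewrite mulN1r.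
Qed.

Lemma ip_suml (I : Type) (s : seq I) (F : I -> V -> R) w :
  (forall i, L2 (F i)) -> L2 w ->
  ip (fun x => \sum_(i <- s) F i x) w = \sum_(i <- s) ip (F i) w.
Proof.
move=> hF hw; rewrite /ip; under eq_avg do rewrite mulr_suml.
by rewrite avg_sum// => i; exact: L2M.
Qed.

Lemma ip_ge0 u : 0 <= ip u u. Proof. exact: avg_sqr_ge0. Qed.

Lemma ip_sqrB u v : L2 u -> L2 v ->
  ip (fun x => u x - v x) (fun x => u x - v x) = ip u u - 2 * ip u v + ip v v.
Proof.
move=> hu hv; have huv := L2B hu hv.
rewrite ipBl// ![ip _ (fun x => _ - _)]ipC !ipBl// (ipC v u); ring.
Qed.

Lemma ip_cauchy_schwarz u v : L2 u -> L2 v ->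
  ip u v ^+ 2 <= ip u u * ip v v.
Proof.
move=> hu hv.
have H t : 0 <= ip u u - 2 * t * ip u v + t ^+ 2 * ip v v.
  have := ip_ge0 (fun x => u x - t * v x).
  rewrite ip_sqrB//; last exact: L2Z.
  rewrite (ipC u (fun x => _ * _)) !ipZl//; last exact: L2Z.
  rewrite (ipC v (fun x => _ * _)) ipZl// (ipC v u).
  by move/le_trans; apply; rewrite expr2 !mulrA.
have := ip_ge0 v; rewrite le_eqVlt => /predU1P[v0|v0].
  rewrite -v0 mulr0; have := H (ip u u + 1).
  have [->|uv] := eqVneq (ip u v) 0; first by rewrite expr0n.
  (* When [ip v v = 0] the polynomial in [t] is affine; at this [t] it takes the value -1. *)
  move=> _; have := H ((ip u u + 1) / (2 * ip u v)).
  rewrite -v0 mulr0 addr0 (_ : 2 * _ * _ = ip u u + 1).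
    by rewrite opprD addrA subrr sub0r oppr_ge0 ler10.
  by field.
(* The minimizer of the quadratic polynomial in [t]. *)
have := H (ip u v / ip v v).
have -> : ip u u - 2 * (ip u v / ip v v) * ip u v + (ip u v / ip v v) ^+ 2 * ip v v
  = (ip u u * ip v v - ip u v ^+ 2) / ip v v by field; rewrite gt_eqF.
by rewrite pmulr_lge0 ?invr_gt0// subr_ge0.
Qed.

Lemma L2_vecB (g h : V -> V) : L2_vec g -> L2_vec h -> L2_vec (fun x => g x - h x).
Proof. by move=> hg hh i; under eq_fun do rewrite !mxE; exact: L2B. Qed.

Lemma L2_vecD (g h : V -> V) : L2_vec g -> L2_vec h -> L2_vec (fun x => g x + h x).
Proof. by move=> hg hh i; under eq_fun do rewrite !mxE; exact: L2D. Qed.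

Lemma L2_vec_cst (z : V) : L2_vec (fun _ : V => z).
Proof. by move=> i; exact: L2_cst. Qed.

Lemma L2_vecZ c g : L2_vec g -> L2_vec (fun x => c *: g x).
Proof. by move=> hg i; under eq_fun do rewrite !mxE; exact: L2Z. Qed.

Lemma L2_vec_sum (I : Type) (s : seq I) (F : I -> V -> V) :
  (forall i, L2_vec (F i)) -> L2_vec (fun x => \sum_(i <- s) F i x).
Proof.
by move=> Fi j; under eq_fun do rewrite summxE; apply: L2_sum => i; exact: Fi.
Qed.

Definition ipV (g h : V -> V) := avg (fun x => dotV (g x) (h x)).

Lemma ipVE (g h : V -> V) : L2_vec g -> L2_vec h ->
  ipV g h = \sum_i ip (fun x => g x ord0 i) (fun x => h x ord0 i).
Proof.
by move=> hg hh; rewrite /ipV avg_sum// => i; exact: (L2M (hg i) (hh i)).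
Qed.

Lemma ipVC (g h : V -> V) : ipV g h = ipV h g.
Proof.
by apply: eq_avg => x; apply: eq_bigr => i _; rewrite mulrC.
Qed.

Lemma integrableQ_dotV (g h : V -> V) : L2_vec g -> L2_vec h ->
  integrableQ (fun x => dotV (g x) (h x)).
Proof. by move=> hg hh; apply: integrableQ_sum => i; exact: (L2M (hg i) (hh i)). Qed.

Lemma ipVDl (g h k : V -> V) : L2_vec g -> L2_vec h -> L2_vec k ->
  ipV (fun x => g x + h x) k = ipV g k + ipV h k.
Proof.
move=> hg hh hk; rewrite /ipV -avgD; try exact: integrableQ_dotV.
apply: eq_avg => x; rewrite /dotV -big_split; apply: eq_bigr => i _ /=.
by rewrite mxE mulrDl.
Qed.

Lemma ipVZl c (g k : V -> V) : L2_vec g -> L2_vec k ->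
  ipV (fun x => c *: g x) k = c * ipV g k.
Proof.
move=> hg hk; rewrite /ipV -avgZ; try exact: integrableQ_dotV.
apply: eq_avg => x; rewrite /dotV mulr_sumr; apply: eq_bigr => i _ /=.
by rewrite mxE mulrA.
Qed.

Lemma ipVBl (g h k : V -> V) : L2_vec g -> L2_vec h -> L2_vec k ->
  ipV (fun x => g x - h x) k = ipV g k - ipV h k.
Proof.
move=> hg hh hk; rewrite -mulN1r -ipVZl// -ipVDl//; last exact: L2_vecZ.
by congr ipV; apply/funext => x; rewrite scaleN1r.
Qed.

Lemma ipV_suml (I : Type) (s : seq I) (F : I -> V -> V) k :
  (forall i, L2_vec (F i)) -> L2_vec k ->
  ipV (fun x => \sum_(i <- s) F i x) k = \sum_(i <- s) ipV (F i) k.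
Proof.
move=> hF hk; rewrite /ipV -avg_sum; last by move=> i; exact: integrableQ_dotV.
apply: eq_avg => x; rewrite /dotV exchange_big/=; apply: eq_bigr => i _ /=.
by rewrite summxE mulr_suml.
Qed.

End L2_theory.

(** * Weak gradients and the elliptic form *)

Section weak_gradient.
Context (R : realType) (d : nat).
Notation V := 'rV[R]_d.
Notation m := (lebesgue_rV R d).
Notation Q := (@cube R d).
Implicit Types (u v w f h : V -> R) (g : V -> V).

Let mQ : measurable Q := @measurable_cube R d.

Lemma smooth_periodic_continuous f : smooth_periodic f -> continuous f.
Proof. by move=> [/(_ 0%N)[]]. Qed.

Lemma smooth_periodic_L2 f : smooth_periodic f -> L2 f.
Proof. by move=> /smooth_periodic_continuous; exact: L2_continuous. Qed.

Lemma smooth_periodic_derivable f j x : smooth_periodic f ->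
  derivable f x (baseV R j).
Proof. by move=> [/(_ 1%N)[_ /(_ j)[]]]. Qed.

Lemma smooth_periodic_derive f j : smooth_periodic f ->
  smooth_periodic (fun x => 'D_(baseV R j) f x).
Proof.
move=> [Cf pf]; split=> [k|x i]; first by have [_ /(_ j)[]] := Cf k.+1.
rewrite /derive; set q := (X in lim (X @ _)); set q' := (X in _ = lim (X @ _)).
suff -> : q = q' by [].
by apply/funext => h; rewrite /q /q' /= addrA !pf.
Qed.

Lemma smooth_periodic_cst (c : R) : smooth_periodic (fun _ : V => c).
Proof.
split=> [k|//]; elim: k c => [|k IH] c; first by split=> //; exact: cst_continuous.
split=> [|i]; first exact: cst_continuous.
split=> [x|]; first exact: derivable_cst.
have -> : (fun x : V => 'D_(baseV R i) (fun _ : V => c) x) = (fun=> 0).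
  by apply/funext => x; exact: derive_cst.
exact: IH.
Qed.

(** Integration by parts has no boundary term: the derivative of the periodic product [f * h]
    integrates to zero. *)
Lemma ip_deriveC f h j : smooth_periodic f -> smooth_periodic h ->
  ip (fun x => 'D_(baseV R j) f x) h = - ip f (fun x => 'D_(baseV R j) h x).
Proof.
move=> sf sh.
have df x := @smooth_periodic_derivable f j x sf.
have dh x := @smooth_periodic_derivable h j x sh.
have cf := smooth_periodic_continuous sf.
have ch := smooth_periodic_continuous sh.
have sf' := smooth_periodic_derive j sf.
have sh' := smooth_periodic_derive j sh.
have E x : 'D_(baseV R j) (f * h) x =
    'D_(baseV R j) f x * h x + f x * 'D_(baseV R j) h x.
  by rewrite (deriveM (df x) (dh x)) addrC [_ *: 'D__ f x]mulrC.
apply/eqP; rewrite -addr_eq0 /ip -avgD; first last.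
- by apply: L2M; exact: smooth_periodic_L2.
- by apply: L2M; exact: smooth_periodic_L2.
have cf' := smooth_periodic_continuous sf'.
have ch' := smooth_periodic_continuous sh'.
have I0 := @integral_derive_periodic R d (f * h) j
  (fun x => cvgM (cf x) (ch x)) (fun x => derivableM (df x) (dh x)).
rewrite /avg /Rintegral; under eq_integral do rewrite -E.
rewrite I0 ?fine0 => [//||x].
- under eq_fun do rewrite E.
  by move=> x; exact: (cvgD (cvgM (cf' x) (ch x)) (cvgM (cf x) (ch' x))).
- have [_ pf] := sf; have [_ ph] := sh.
  by rewrite -[LHS]/(f (x + baseV R j) * h (x + baseV R j)) pf ph.
Qed.

Lemma enormV_sqr (z : V) : enormV z ^+ 2 = dotV z z.
Proof.
by rewrite sqr_sqrtr// sumr_ge0// => i _; rewrite -expr2 sqr_ge0.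
Qed.

Lemma sqr_coord_le_dotV (z : V) j : z ord0 j * z ord0 j <= dotV z z.
Proof.
rewrite /dotV (bigD1 j)//= lerDl sumr_ge0// => i _.
by rewrite -expr2 sqr_ge0.
Qed.

(** The approximation in [H1per] controls one extended-real integral of a sum of squares; this
    extracts a real bound on each summand. *)
Lemma ip_lt_of_integral (e : R) u (G : V -> R) : L2 u ->
  measurable_fun Q G -> (forall x, u x ^+ 2 <= G x) ->
  (\int[m]_(x in Q) (G x)%:E < e%:E)%E -> ip u u < e.
Proof.
move=> hu mG uG Ge.
have ui := L2M hu hu.
rewrite /ip /avg /Rintegral -lte_fin fineK; last exact: integrable_fin_num.
apply: le_lt_trans Ge; apply: ge0_le_integral => //.
- by move=> x _; rewrite lee_fin -expr2 sqr_ge0.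
- by apply/measurable_EFinP; apply: measurable_funM; exact: hu.1.
- exact/measurable_EFinP.
- by move=> x _; rewrite lee_fin -expr2.
Qed.

Lemma H1per_approx w g (e : R) : H1per w g -> 0 < e ->
  exists2 f, smooth_periodic f &
    ip (fun x => w x - f x) (fun x => w x - f x) < e /\
    forall j, ip (fun x => g x ord0 j - 'D_(baseV R j) f x)
                 (fun x => g x ord0 j - 'D_(baseV R j) f x) < e.
Proof.
move=> [hw hg happ] e0; have [f sf fe] := happ e e0; exists f => //.
have hwf := L2B hw (smooth_periodic_L2 sf).
have hgf j := L2B (hg j) (smooth_periodic_L2 (smooth_periodic_derive j sf)).
have EG x : enormV (g x - grad f x) ^+ 2 =
    \sum_j (g x ord0 j - 'D_(baseV R j) f x) ^+ 2.
  by rewrite enormV_sqr; apply: eq_bigr => j _; rewrite !mxE expr2.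
have mG : measurable_fun Q (fun x => (w x - f x) ^+ 2 + enormV (g x - grad f x) ^+ 2).
  under eq_fun do rewrite EG.
  apply: measurable_funD; first by apply: measurable_funX; exact: hwf.1.
  apply: measurable_sum => j; apply: measurable_funX.
  exact: (hgf j).1.
split=> [|j]; apply: ip_lt_of_integral mG _ fe => //.
- by move=> x; rewrite lerDl sqr_ge0.
- move=> x; rewrite -[leLHS]add0r lerD ?sqr_ge0// EG (bigD1 j)//= lerDl.
  by rewrite sumr_ge0// => i _; rewrite sqr_ge0.
Qed.

Lemma le0_of_small (x M : R) : (forall e, 0 < e -> x <= e * M) -> x <= 0.
Proof.
move=> H; have [M0|M0] := leP M 0.
  by apply: le_trans (H 1 ltr01) _; rewrite mul1r.
apply/ler_addgt0Pr => e e0; rewrite add0r.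
by apply: le_trans (H (e / M) _) _; rewrite ?divr_gt0// divfK// gt_eqF.
Qed.

(** For a smooth approximation [h] of [w] the identity is integration by parts. The defect for [w]
    is therefore a pairing with [w - h] and its gradient, which Cauchy-Schwarz makes arbitrarily
    small. *)
Lemma H1per_weak_gradient w g f j : H1per w g -> smooth_periodic f ->
  ip (fun x => g x ord0 j) f = - ip w (fun x => 'D_(baseV R j) f x).
Proof.
move=> hw sf; have [Lw Lg _] := hw.
have Lf := smooth_periodic_L2 sf.
have Ldf := smooth_periodic_L2 (smooth_periodic_derive j sf).
set df := (fun x => 'D_(baseV R j) f x) in Ldf *.
apply/eqP; rewrite -addr_eq0 -sqrf_eq0 eq_le sqr_ge0 andbT.
(* The constant comes from [(p + q) ^+ 2 <= 2 * (p ^+ 2 + q ^+ 2)] and Cauchy-Schwarz on each of the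
   two pairings. *)
apply: (@le0_of_small _ (2 * (ip f f + ip df df))) => e e0.
have [h sh [he hge]] := H1per_approx hw e0.
have Lh := smooth_periodic_L2 sh.
have Ldh := smooth_periodic_L2 (smooth_periodic_derive j sh).
have -> : ip (fun x => g x ord0 j) f + ip w df =
    ip (fun x => g x ord0 j - 'D_(baseV R j) h x) f + ip (fun x => w x - h x) df.
  rewrite !ipBl// ip_deriveC// -/df; ring.
have := ip_cauchy_schwarz (L2B (Lg j) Ldh) Lf.
have := ip_cauchy_schwarz (L2B Lw Lh) Ldf.
have := hge j; have := ip_ge0 f; have := ip_ge0 df; move: he.
move: (ip _ f) (ip _ df) (ip f f) (ip df df) => p q F G.
move: (ip _ _) (ip _ _) => a b ae G0 F0 be qa pb.
have : q ^+ 2 <= e * G by apply: le_trans qa _; rewrite ler_wpM2r// ltW.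
have : p ^+ 2 <= e * F by apply: le_trans pb _; rewrite ler_wpM2r// ltW.
have := sqr_ge0 (p - q).
move=> *; nra.
Qed.

Lemma H1per_cst (c : R) : H1per (fun _ : V => c) (fun=> 0).
Proof.
split; [exact: L2_cst|by move=> i; exact: L2_cst|move=> e e0].
exists (fun=> c); first exact: smooth_periodic_cst.
rewrite (eq_integral (fun=> 0%E)) ?integral0 ?lte_fin// => x _.
rewrite subrr expr0n/= add0r enormV_sqr /dotV big1// => i _.
by rewrite !mxE derive_cst subrr mulr0.
Qed.

End weak_gradient.

(** * The bilinear form attached to [A] *)

Section elliptic_form.
Context (R : realType) (d : nat) (alpha beta : R) (A : 'rV[R]_d -> 'M[R]_d).
Context (hA : elliptic_coef alpha beta A).
Notation V := 'rV[R]_d.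
Notation m := (lebesgue_rV R d).
Implicit Types (g h k : V -> V).

Lemma appVE (M : 'M[R]_d) (z : V) i : appV M z ord0 i = \sum_j M i j * z ord0 j.
Proof. by rewrite !mxE; apply: eq_bigr => j _; rewrite !mxE mulrC. Qed.

Lemma dotVC (y z : V) : dotV y z = dotV z y.
Proof. by apply: eq_bigr => i _; rewrite mulrC. Qed.

Lemma dotV_appV_sym (M : 'M[R]_d) (y z : V) : M^T = M ->
  dotV (appV M y) z = dotV y (appV M z).
Proof.
move=> MT; rewrite /dotV.
under eq_bigr do rewrite appVE mulr_suml.
rewrite exchange_big/=; apply: eq_bigr => j _.
rewrite appVE mulr_sumr; apply: eq_bigr => i _.
by rewrite -[in RHS]MT mxE [_ * y _ _]mulrC mulrA.
Qed.

(** The entry is a coordinate of the image of the unit vector [baseV R j], whose norm is at most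
    [beta]. *)
Lemma elliptic_entry_bound i j : {ae m, forall x, `|A x i j| <= beta}.
Proof.
near=> x.
have /(_ (baseV R j)) : forall z, enormV (appV (A x) z) <= beta * enormV z.
  by near: x; exact: coef_bounded hA.
have -> : enormV (baseV R j) = 1.
  rewrite /enormV /dotV (bigD1 j)//= big1 => [|l lj]; last first.
    by rewrite !mxE eqxx (negbTE lj) mulr0.
  by rewrite !mxE !eqxx mulr1 addr0 sqrtr1.
rewrite mulr1; apply: le_trans.
rewrite -sqrtr_sqr ler_wsqrtr// expr2.
apply: le_trans (sqr_coord_le_dotV _ i).
rewrite appVE (bigD1 j)//= big1 => [|l lj].
  by rewrite !mxE !eqxx mulr1 addr0.
by rewrite !mxE (negbTE lj) andbF mulr0.
Unshelve. all: by end_near. Qed.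

Lemma L2_vec_appV g : L2_vec g -> L2_vec (fun x => appV (A x) (g x)).
Proof.
move=> hg i; under eq_fun do rewrite appVE.
apply: L2_sum => j; apply: L2_bounded_mul (hg j).
  exact: coef_measurable hA i j.
exact: elliptic_entry_bound.
Qed.

(** The form takes vector fields instead of functions, so that the constant field [xi] can be
    inserted next to gradients of periodic functions. *)
Definition aform g h := ipV (fun x => appV (A x) (g x)) h.

Lemma aformC g h : aform g h = aform h g.
Proof.
rewrite /aform [RHS]ipVC; apply: eq_avg => x.
by apply: dotV_appV_sym; exact: coef_sym hA x.
Qed.

Lemma aformDl g h k : L2_vec g -> L2_vec h -> L2_vec k ->
  aform (fun x => g x + h x) k = aform g k + aform h k.
Proof.
move=> hg hh hk; rewrite /aform -ipVDl//; try exact: L2_vec_appV.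
by congr ipV; apply/funext => x; rewrite /appV mulmxDl.
Qed.

Lemma aformZl c g k : L2_vec g -> L2_vec k ->
  aform (fun x => c *: g x) k = c * aform g k.
Proof.
move=> hg hk; rewrite /aform -ipVZl//; try exact: L2_vec_appV.
by congr ipV; apply/funext => x; rewrite /appV scalemxAl.
Qed.

Lemma aformBl g h k : L2_vec g -> L2_vec h -> L2_vec k ->
  aform (fun x => g x - h x) k = aform g k - aform h k.
Proof.
move=> hg hh hk; rewrite /aform -ipVBl//; try exact: L2_vec_appV.
by congr ipV; apply/funext => x; rewrite /appV mulmxBl.
Qed.

Lemma aform_suml (I : Type) (s : seq I) (c : I -> R) (F : I -> V -> V) k :
  (forall i, L2_vec (F i)) -> L2_vec k ->
  aform (fun x => \sum_(i <- s) c i *: F i x) k = \sum_(i <- s) c i * aform (F i) k.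
Proof.
move=> hF hk; under [RHS]eq_bigr do rewrite -aformZl//.
rewrite /aform -ipV_suml//; last by move=> i; apply: L2_vec_appV; exact: L2_vecZ.
by congr ipV; apply/funext => x; rewrite /appV mulmx_suml.
Qed.

Lemma aform_coercive g j : L2_vec g ->
  alpha * ip (fun x => g x ord0 j) (fun x => g x ord0 j) <= aform g g.
Proof.
move=> hg; have [a0 _] := coef_bounds hA.
rewrite /ip -avgZ; last exact: (L2M (hg j) (hg j)).
apply: ae_le_avg.
- by apply: integrableQZ; exact: (L2M (hg j) (hg j)).
- by apply: integrableQ_dotV => //; exact: L2_vec_appV.
near=> x.
have /(_ (g x)) : forall z, alpha * enormV z ^+ 2 <= dotV z (appV (A x) z).
  by near: x; exact: coef_coercive hA.
rewrite enormV_sqr dotVC; apply: le_trans.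
by rewrite ler_wpM2l ?(ltW a0)// sqr_coord_le_dotV.
Unshelve. all: by end_near. Qed.

Lemma aform_ge0 g : L2_vec g -> 0 <= aform g g.
Proof.
move=> hg; have [a0 _] := coef_bounds hA.
have -> : 0 = avg (fun _ : V => 0) :> R.
  by rewrite /avg Rintegral_cst ?mul0r//; exact: measurable_cube.
apply: ae_le_avg.
- have := L2M (L2_cst d (0 : R)) (L2_cst d (0 : R)).
  by under eq_fun do rewrite mulr0.
- by apply: integrableQ_dotV => //; exact: L2_vec_appV.
near=> x.
have /(_ (g x)) : forall z, alpha * enormV z ^+ 2 <= dotV z (appV (A x) z).
  by near: x; exact: coef_coercive hA.
by rewrite dotVC; apply: le_trans; rewrite mulr_ge0 ?sqr_ge0// ltW.
Unshelve. all: by end_near. Qed.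

End elliptic_form.

(** * Expansion in eigenfunctions *)

Lemma sqr_cvg0 (R : realType) (x : R^nat) :
  (fun n => x n ^+ 2) @ \oo --> (0 : R) -> x @ \oo --> (0 : R).
Proof.
move=> /cvgr0Pnorm_lt H; apply/cvgr0Pnorm_lt => e e0; near=> n.
have : `|x n ^+ 2| < e ^+ 2 by near: n; apply: H; rewrite exprn_gt0.
by rewrite normrX ltr_pXn2r// ?nnegrE// ltW.
Unshelve. all: by end_near. Qed.

Lemma cvgn_sum (R : realType) (I : Type) (s : seq I) (f : I -> R^nat) (l : I -> R) :
  (forall i, f i @ \oo --> l i) ->
  (fun n => \sum_(i <- s) f i n) @ \oo --> \sum_(i <- s) l i.
Proof.
by move=> fl; apply: cvg_big => //; exact: add_continuous.
Qed.

Lemma ip_cvg0 (R : realType) (d : nat) (r : nat -> 'rV[R]_d -> R) h :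
  (forall n, L2 (r n)) -> L2 h -> (fun n => ip (r n) (r n)) @ \oo --> (0 : R) ->
  (fun n => ip h (r n)) @ \oo --> (0 : R).
Proof.
move=> Lr Lh r0; apply: sqr_cvg0.
apply: (@squeeze_cvgr _ _ _ _ (fun=> 0) (fun n => ip h h * ip (r n) (r n))).
- by near=> n; rewrite sqr_ge0/= ip_cauchy_schwarz.
- exact: cvg_cst.
- by rewrite -[X in _ --> X](mulr0 (ip h h)); apply: cvgM => //; exact: cvg_cst.
Unshelve. all: by end_near. Qed.

Section eigenfunction_expansion.
Context (R : realType) (d : nat) (alpha beta : R) (A : 'rV[R]_d -> 'M[R]_d).
Context (hA : elliptic_coef alpha beta A).
Context (psi : nat -> 'rV[R]_d -> R) (gpsi : nat -> 'rV[R]_d -> 'rV[R]_d).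
Context (lam : nat -> R) (hpsi : periodic_eigenbasis A psi gpsi lam).
Notation V := 'rV[R]_d.

Let Lpsi i : L2 (psi i). Proof. by have [] := eigen_H1 hpsi i. Qed.

Let Lgpsi i : L2_vec (gpsi i). Proof. by have [] := eigen_H1 hpsi i. Qed.

Lemma eigen_gt0 i : 0 < lam i.
Proof. exact: lt_le_trans (eigen_pos hpsi) (eigen_sorted hpsi (leq0n i)). Qed.

Definition residual (v : V -> R) n x :=
  v x - \sum_(0 <= i < n) ip v (psi i) * psi i x.

Lemma L2_residual v n : L2 v -> L2 (residual v n).
Proof.
move=> Lv; apply: L2B => //; apply: L2_sum => i; exact: L2Z.
Qed.

Lemma residual_cvg0 v : L2_mean0 v ->
  (fun n => ip (residual v n) (residual v n)) @ \oo --> (0 : R).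
Proof.
move=> /(eigen_complete hpsi); apply: cvg_trans; apply: near_eq_cvg.
near=> n; apply: eq_avg => x; rewrite -expr2 /residual big_mkord.
by [].
Unshelve. all: by end_near. Qed.

Lemma ip_residual v n w : L2 v -> L2 w ->
  ip (residual v n) w = ip v w - \sum_(0 <= i < n) ip v (psi i) * ip (psi i) w.
Proof.
move=> Lv Lw; rewrite /residual ipBl//; last by apply: L2_sum => i; exact: L2Z.
rewrite ip_suml//; last by move=> i; exact: L2Z.
by congr (_ - _); apply: eq_bigr => i _; rewrite ipZl.
Qed.

(** The partial sum differs from [ip v w] by the pairing of [w] with the residual of [v], which
    tends to zero in L2 by completeness. *)
Lemma parseval v w : L2_mean0 v -> L2_mean0 w ->
  (fun n => \sum_(0 <= i < n) ip v (psi i) * ip w (psi i)) @ \oo --> ip v w.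
Proof.
move=> [Lv v0] [Lw w0].
have -> : (fun n => \sum_(0 <= i < n) ip v (psi i) * ip w (psi i)) =
          (fun n => ip v w - ip w (residual v n)).
  apply/funext => n; rewrite (ipC w) ip_residual// opprB addrC subrK.
  by apply: eq_bigr => i _; rewrite (ipC w).
rewrite -[X in _ --> X]subr0; apply: cvgB; first exact: cvg_cst.
apply: ip_cvg0 => //; first by move=> n; exact: L2_residual.
exact: residual_cvg0.
Qed.

(** * Convergence of the eigenfunction expansion in energy *)

Section energy.
Context (phi : V -> R) (gphi : V -> V).
Context (hphi : H1per phi gphi) (phi0 : avg phi = 0).

Let Lphi : L2 phi. Proof. by have [] := hphi. Qed.

Let Lgphi : L2_vec gphi. Proof. by have [] := hphi. Qed.

Let p i := ip phi (psi i).

Let g n x : V := gphi x - \sum_(0 <= i < n) p i *: gpsi i x.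

Let Lg n : L2_vec (g n).
Proof. by apply: L2_vecB => //; apply: L2_vec_sum => i; exact: L2_vecZ. Qed.

(** By [aform_gg] with [k = n] this is the energy of the residual gradient [g n]; the aim is that it
    tends to zero. *)
Let E n := aform A gphi gphi - \sum_(0 <= i < n) lam i * p i ^+ 2.

Let aform_gl n h : L2_vec h ->
  aform A (g n) h = aform A gphi h - \sum_(0 <= i < n) p i * aform A (gpsi i) h.
Proof.
move=> Lh; rewrite (aformBl hA)//; last by apply: L2_vec_sum => i; exact: L2_vecZ.
by rewrite (aform_suml hA).
Qed.

Let aform_psi i w gw : H1per w gw -> aform A (gpsi i) gw = lam i * ip (psi i) w.
Proof. exact: eigen_eq. Qed.

Let aform_g_phi n : aform A (g n) gphi = E n.
Proof.
rewrite aform_gl//; congr (_ - _); apply: eq_bigr => i _.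
by rewrite (aform_psi i hphi) (ipC (psi i)) -/(p i) mulrCA expr2.
Qed.

(** The eigenvalue equation turns both contributions into [lam i * p i], orthonormality leaving only
    the term of index [i] in the sum. *)
Let aform_g_psi n i : (i < n)%N -> aform A (g n) (gpsi i) = 0.
Proof.
move=> iltn; rewrite aform_gl// (aformC hA) (aform_psi i hphi) (ipC (psi i)).
rewrite -/(p i) big_mkord (bigD1 (Ordinal iltn))//= big1 => [|k ki].
  rewrite (aform_psi i (eigen_H1 hpsi i)) /ip (eigen_orthonormal hpsi) eqxx.
  by rewrite mulr1 addr0 mulrC subrr.
rewrite (aform_psi k (eigen_H1 hpsi i)) /ip (eigen_orthonormal hpsi).
rewrite (_ : (k == i :> nat) = false) ?mulr0//.
by apply: contraNF ki => /eqP ki; apply/eqP/val_inj.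
Qed.

(** The later residual is energy-orthogonal to the eigenfunctions removed in [g n], so only [gphi]
    contributes. *)
Let aform_gg n k : (n <= k)%N -> aform A (g n) (g k) = E k.
Proof.
move=> nk; rewrite aform_gl// (aformC hA gphi) aform_g_phi big_nat big1 ?subr0//.
move=> i /andP[_ iltn].
by rewrite (aformC hA) aform_g_psi ?mulr0// (leq_trans iltn).
Qed.

Let a0 : 0 < alpha. Proof. by have [] := coef_bounds hA. Qed.

Let coord_ip j n k :=
  ip (fun x => g n x ord0 j) (fun x => g k x ord0 j).

(* The energy orthogonality of the residuals makes their gradients Cauchy. *)
Let coord_ip_le j n k : (n <= k)%N ->
  alpha * coord_ip j n n <= E n - E k + 2 * alpha * coord_ip j n k.
Proof.
move=> nk.
have Lgj l : L2 (fun x => g l x ord0 j) := Lg l j.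
have := aform_coercive hA j (L2_vecB (Lg n) (Lg k)).
have -> : aform A (fun x => g n x - g k x) (fun x => g n x - g k x) = E n - E k.
  have gD l : aform A (g l) (fun x => g n x - g k x) =
      aform A (g n) (g l) - aform A (g k) (g l).
    by rewrite (aformC hA) (aformBl hA).
  rewrite (aformBl hA)//; last exact: L2_vecB.
  by rewrite !gD (aformC hA (g k) (g n)) !aform_gg// subrr subr0.
have -> : (fun x => (g n x - g k x) ord0 j) =
    (fun x => g n x ord0 j - g k x ord0 j) by apply/funext => x; rewrite !mxE.
rewrite ip_sqrB// -/(coord_ip j n n) -/(coord_ip j n k) -/(coord_ip j k k).
have : 0 <= alpha * coord_ip j k k by rewrite mulr_ge0 ?ip_ge0// ltW.
move: (coord_ip j n n) (coord_ip j n k) (coord_ip j k k) => a b c.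
by rewrite mulrDr mulrBr; lra.
Qed.

Let E_ge0 n : 0 <= E n.
Proof. by rewrite -(aform_gg (leqnn n)); exact: aform_ge0 hA _ (Lg n). Qed.

Let E_decr n : E n.+1 <= E n.
Proof.
by rewrite /E lerD2l lerN2 big_nat_recr//= lerDl mulr_ge0 ?sqr_ge0// ltW// eigen_gt0.
Qed.

Let E_le n : E n <= E 0%N.
Proof. by elim: n => // n; apply: le_trans; exact: E_decr. Qed.

Let coord_ip_bound j n : coord_ip j n n <= E 0%N / alpha.
Proof.
rewrite ler_pdivlMr// mulrC.
apply: le_trans (E_le n); rewrite -(aform_gg (leqnn n)).
exact: (aform_coercive hA j (Lg n)).
Qed.

Let ip_coord j n h : L2 h -> ip (fun x => g n x ord0 j) h =
  ip (fun x => gphi x ord0 j) h -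
  \sum_(0 <= i < n) p i * ip (fun x => gpsi i x ord0 j) h.
Proof.
move=> Lh; have Lp i : L2 (fun x => p i * gpsi i x ord0 j) := L2Z (p i) (Lgpsi i j).
have -> : (fun x => g n x ord0 j) =
    (fun x => gphi x ord0 j - \sum_(0 <= i < n) p i * gpsi i x ord0 j).
  apply/funext => x; rewrite !mxE summxE; congr (_ - _).
  by apply: eq_bigr => i _; rewrite mxE.
rewrite (ipBl (Lgphi j) (L2_sum _ Lp) Lh) (ip_suml _ Lp Lh).
by congr (_ - _); apply: eq_bigr => i _; rewrite (ipZl _ (Lgpsi i j) Lh).
Qed.

(** The derivative moves onto [f], which leaves the residual itself, known to tend to zero in L2. *)
Let coord_weak_gradient f j n : smooth_periodic f ->
  ip f (fun x => g n x ord0 j) =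
  - ip (fun x => 'D_(baseV R j) f x) (residual phi n).
Proof.
move=> sf; have Lf := smooth_periodic_L2 sf.
have Ldf := smooth_periodic_L2 (smooth_periodic_derive j sf).
rewrite ipC [in RHS]ipC ip_residual// ip_coord// (H1per_weak_gradient j hphi sf).
rewrite opprB addrC; congr (_ + _); rewrite -sumrN; apply: eq_bigr => i _.
by rewrite (H1per_weak_gradient j (eigen_H1 hpsi i) sf) mulrN opprK.
Qed.

(** Replace [gw] by the gradient of a smooth [f]: the pairing with ['D_(baseV R j) f] tends to zero
    by a further integration by parts, and the error is uniformly small since the residual gradients
    are bounded in L2. *)
Let coord_weak_cvg0 w gw j : H1per w gw ->
  (fun n => ip (fun x => gw x ord0 j) (fun x => g n x ord0 j)) @ \oo --> (0 : R).
Proof.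
move=> hw; have [_ Lgw _] := hw.
apply/cvgr0Pnorm_lt => e e0.
(* A bound for [coord_ip j n n] uniform in [n]; adding 1 keeps it positive when [E 0%N] vanishes.
   The tolerance [(e / 2) ^+ 2 / C] then makes the Cauchy-Schwarz bound equal to [(e / 2) ^+ 2]. *)
pose C := E 0%N / alpha + 1.
have C0 : 0 < C by rewrite ltr_wpDl// divr_ge0 ?E_ge0// ltW.
have [|f sf [_ /(_ j) fe]] := H1per_approx hw (e := (e / 2) ^+ 2 / C).
  by rewrite divr_gt0// exprn_gt0// divr_gt0.
have sdf := smooth_periodic_derive j sf.
have Ldf := smooth_periodic_L2 sdf.
have : (fun n => ip (fun x => 'D_(baseV R j) f x) (fun x => g n x ord0 j))
    @ \oo --> (0 : R).
  have -> : (fun n => ip (fun x => 'D_(baseV R j) f x) (fun x => g n x ord0 j)) =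
      (fun n => - ip (fun x => 'D_(baseV R j) (fun y => 'D_(baseV R j) f y) x)
                     (residual phi n)).
    by apply/funext => n; rewrite coord_weak_gradient.
  rewrite -[X in _ --> X]oppr0; apply: cvgN.
  apply: ip_cvg0; [by move=> n; exact: L2_residual| |exact: residual_cvg0].
  exact: smooth_periodic_L2 (smooth_periodic_derive j sdf).
move=> /cvgr0Pnorm_lt H; near=> n.
have -> : ip (fun x => gw x ord0 j) (fun x => g n x ord0 j) =
   ip (fun x => gw x ord0 j - 'D_(baseV R j) f x) (fun x => g n x ord0 j) +
   ip (fun x => 'D_(baseV R j) f x) (fun x => g n x ord0 j).
  by rewrite ipBl ?subrK//; exact: Lg.
apply: le_lt_trans (ler_normD _ _) _; rewrite [e]splitr; apply: ler_ltD; last first.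
  by near: n; apply: H; rewrite divr_gt0.
rewrite -(@ler_pXn2r _ 2)// ?nnegrE ?divr_ge0 ?(ltW e0)//.
rewrite real_normK ?num_real//.
apply: le_trans (ip_cauchy_schwarz (L2B (Lgw j) Ldf) (Lg n j)) _.
rewrite -[leRHS](@divfK _ C) ?gt_eqF//; apply: ler_pM; rewrite ?ip_ge0 ?(ltW fe)//.
by apply: le_trans (coord_ip_bound j n) _; rewrite /C lerDl.
Unshelve. all: by end_near. Qed.

(** For fixed [n] the field [g n] is a finite combination of weak gradients, to each of which the
    weak convergence applies. *)
Let coord_ip_cvg0 j n : (fun k => coord_ip j n k) @ \oo --> (0 : R).
Proof.
have -> : (fun k => coord_ip j n k) = (fun k =>
    ip (fun x => gphi x ord0 j) (fun x => g k x ord0 j) -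
    \sum_(0 <= i < n) p i * ip (fun x => gpsi i x ord0 j) (fun x => g k x ord0 j)).
  by apply/funext => k; rewrite /coord_ip ip_coord//; exact: Lg.
rewrite -[X in _ --> X]subr0; apply: cvgB; first exact: coord_weak_cvg0 hphi.
rewrite -[X in _ --> X](@big1 R 0 +%R nat (index_iota 0 n) xpredT (fun=> 0))//.
apply: cvgn_sum => i; rewrite -[X in _ --> X](mulr0 (p i)).
by apply: cvgM; [exact: cvg_cst|exact: coord_weak_cvg0 (eigen_H1 hpsi i)].
Qed.

Lemma energy_parseval :
  (fun n => \sum_(0 <= i < n) lam i * ip phi (psi i) ^+ 2) @ \oo -->
  aform A gphi gphi.
Proof.
have Ecvg : cvgn E.
  apply: nonincreasing_is_cvgn; first exact/nonincreasing_seqP.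
  by exists 0 => _ [n _ <-]; exact: E_ge0.
have Elim : E @ \oo --> limn E by [].
(* Let [k] tend to infinity in [coord_ip_le]: the cross term disappears by weak convergence. The
   value of [limn E] is not yet known. *)
have diag_le j n : alpha * coord_ip j n n <= E n - limn E.
  have H : (fun k => E n - E k + 2 * alpha * coord_ip j n k) @ \oo -->
      E n - limn E + 2 * alpha * 0.
    apply: cvgD; first by apply: cvgB => //; exact: cvg_cst.
    by apply: cvgM; [exact: cvg_cst|exact: coord_ip_cvg0].
  rewrite mulr0 addr0 in H; rewrite -(cvg_lim (@Rhausdorff R) H).
  apply: limr_ge; first exact: cvgP H.
  by near=> k; apply: coord_ip_le; near: k; exact: nbhs_infty_ge.
have diag0 j : (fun n => coord_ip j n n) @ \oo --> (0 : R).
  apply: (@squeeze_cvgr _ _ _ _ (fun=> 0) (fun n => (E n - limn E) / alpha)).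
  - near=> n; rewrite ip_ge0/= ler_pdivlMr// mulrC.
    exact: diag_le.
  - exact: cvg_cst.
  - rewrite -[X in _ --> X](mul0r alpha^-1) -(subrr (limn E)).
    by apply: cvgM; [apply: cvgB => //; exact: cvg_cst|exact: cvg_cst].
(* [E n] is the pairing of the fixed L2 field [A gphi] with [g n], whose coordinates now tend to
   zero in L2. *)
have E0 : E @ \oo --> (0 : R).
  have -> : E = (fun n => \sum_j ip (fun x => appV (A x) (gphi x) ord0 j)
                                   (fun x => g n x ord0 j)).
    apply/funext => n; rewrite -aform_g_phi (aformC hA) /aform ipVE//.
    exact: L2_vec_appV hA _ Lgphi.
  rewrite -[X in _ --> X](@big1 R 0 +%R 'I_d (index_enum 'I_d) xpredT (fun=> 0))//.
  apply: cvgn_sum => j; apply: ip_cvg0 => //.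
  - by move=> n; exact: Lg.
  - exact: L2_vec_appV hA _ Lgphi j.
  - exact: diag0.
have -> : (fun n => \sum_(0 <= i < n) lam i * ip phi (psi i) ^+ 2) =
    (fun n => aform A gphi gphi - E n).
  by apply/funext => n; rewrite /E opprB addrC subrK.
by rewrite -[X in _ --> X]subr0; apply: cvgB => //; exact: cvg_cst.
Unshelve. all: by end_near. Qed.

End energy.

End eigenfunction_expansion.

(** * Correctors and the spectral measure *)

Lemma corrector_form_cvg (R : realType) (eta : nat -> nat -> R)
    (nu : nat -> nat -> nat -> R) k (W : nat -> nat -> nat -> R)
    (w : nat -> nat -> R) :
  (forall i j, (fun n => W n i j) @ \oo --> w i j) ->
  (fun n => corrector_form eta nu k (W n)) @ \oo --> corrector_form eta nu k w.
Proof.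
move=> Ww; apply: cvgD; apply: cvgn_sum => i.
  by apply: cvgM; [exact: cvg_cst|exact: Ww].
by apply: cvgn_sum => j; apply: cvgM; [exact: cvg_cst|exact: Ww].
Qed.

Section correctors.
Context (R : realType) (d : nat) (alpha beta : R) (A : 'rV[R]_d -> 'M[R]_d).
Context (hA : elliptic_coef alpha beta A).
Context (psi : nat -> 'rV[R]_d -> R) (gpsi : nat -> 'rV[R]_d -> 'rV[R]_d).
Context (lam : nat -> R) (hpsi : periodic_eigenbasis A psi gpsi lam).
Context (xi : 'rV[R]_d).
Notation V := 'rV[R]_d.

Section one_corrector.
Context (m : R) (phi : V -> R) (gphi : V -> V).
Context (m0 : 0 < m) (hphi : modified_corrector A xi m phi gphi).

Let Lxi : L2_vec (fun _ : V => xi) := L2_vec_cst xi.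

Let Lg : L2_vec gphi. Proof. by have [[]] := hphi. Qed.

Lemma corrector_eq w gw : H1per w gw ->
  m * ip phi w + aform A (fun=> xi) gw + aform A gphi gw = 0.
Proof.
move=> hw; have [_ Lgw _] := hw; have [_ /(_ w gw hw) <-] := hphi.
by rewrite -addrA -(aformDl hA Lxi Lg Lgw).
Qed.

(** Testing the equation with the constant 1 leaves [m * avg phi = 0]. *)
Lemma corrector_mean0 : avg phi = 0.
Proof.
have [_ /(_ _ _ (H1per_cst d (1 : R)))] := hphi.
have -> : avg (fun x => dotV (appV (A x) (xi + gphi x)) 0) = 0.
  rewrite (eq_avg (h := fun=> 0)); last first.
    by move=> x; rewrite /dotV big1// => i _; rewrite [X in _ * X]mxE mulr0.
  by rewrite /avg Rintegral_cst ?mul0r//; exact: measurable_cube.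
under eq_avg do rewrite mulr1.
by rewrite addr0 => /eqP; rewrite mulf_eq0 gt_eqF//= => /eqP.
Qed.

Lemma L2_mean0_corrector : L2_mean0 phi.
Proof. by split; [have [[]] := hphi|exact: corrector_mean0]. Qed.

Lemma corrector_coef i : ip phi (psi i) = drift A xi (gpsi i) / (m + lam i).
Proof.
have [hH _] := hphi; have l0 := eigen_gt0 hpsi i.
have := corrector_eq (eigen_H1 hpsi i).
rewrite (aformC hA gphi) [aform A (gpsi i) gphi](eigen_eq hpsi i hH).
rewrite -[avg _]/(ip (psi i) phi) (ipC (psi i)).
rewrite /drift -[avg _]/(aform A (fun=> xi) (gpsi i)).
move=> H; apply: (canRL (mulfK _)); first by rewrite gt_eqF// addr_gt0.
apply/eqP; rewrite -addr_eq0; apply/eqP; rewrite -[RHS]H; ring.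
Qed.

(** The corrector is its own test function: this expresses the cross term [aform A (fun=> xi) gphi],
    which occurs twice when the energy is expanded. *)
Lemma corrector_energy :
  avg (fun x => dotV (xi + gphi x) (appV (A x) (xi + gphi x))) =
  avg (fun x => dotV xi (appV (A x) xi)) -
  (2 * m * ip phi phi + aform A gphi gphi).
Proof.
have [hH _] := hphi; have Lxg := L2_vecD Lxi Lg.
rewrite -[avg _]/(ipV (fun x => xi + gphi x) _) ipVC.
rewrite -[ipV _ _]/(aform A (fun x => xi + gphi x) (fun x => xi + gphi x)).
rewrite -[X in _ = X - _]/(ipV (fun=> xi) _) ipVC.
rewrite -[ipV _ _]/(aform A (fun=> xi) (fun=> xi)).
rewrite (aformDl hA Lxi Lg Lxg) !(aformC hA _ (fun x => xi + gphi x)).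
rewrite (aformDl hA Lxi Lg Lxi) (aformDl hA Lxi Lg Lg).
have := corrector_eq hH; rewrite (aformC hA gphi (fun=> xi)).
by move=> H; lra.
Qed.

(** Adds Parseval's identity in L2, weighted by [2 * m], to the one in energy. By [corrector_coef],
    the terms are the squared drift coefficients times [(2 * m + lam i) / (m + lam i) ^+ 2]. *)
Lemma corrector_energy_cvg :
  (fun n => \sum_(0 <= i < n) (2 * m + lam i) * ip phi (psi i) ^+ 2) @ \oo -->
  2 * m * ip phi phi + aform A gphi gphi.
Proof.
have [hH _] := hphi.
have -> : (fun n => \sum_(0 <= i < n) (2 * m + lam i) * ip phi (psi i) ^+ 2) =
    (fun n => 2 * m * (\sum_(0 <= i < n) ip phi (psi i) * ip phi (psi i)) +
              \sum_(0 <= i < n) lam i * ip phi (psi i) ^+ 2).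
  apply/funext => n; rewrite mulr_sumr -big_split; apply: eq_bigr => i _ /=.
  by rewrite mulrDl expr2.
apply: cvgD; last exact: (energy_parseval hA hpsi hH corrector_mean0).
apply: cvgM; first exact: cvg_cst.
exact: (parseval hpsi L2_mean0_corrector L2_mean0_corrector).
Qed.

End one_corrector.

(** The measure is a series of weighted Dirac masses, so a nonnegative function integrates term by
    term; all atoms lie in the domain because the eigenvalues are positive. *)
Lemma spectral_integral (f : R -> R) (l : R) :
  (forall t, 0 < t -> 0 <= f t) ->
  measurable_fun (`]0, +oo[ : set R) f ->
  (fun n => \sum_(0 <= i < n) drift A xi (gpsi i) ^+ 2 * f (lam i)) @ \oo --> l ->
  \int[spectral_measure A gpsi lam xi]_(t in `]0, +oo[) f t = l.
Proof.
move=> f0 mf fl.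
have mEf : measurable_fun (`]0, +oo[ : set R) (EFin \o f) by exact/measurable_EFinP.
have f0' t : (`]0%R, +oo[%classic : set R) t -> (0 <= (f t)%:E)%E.
  by rewrite /= in_itv/= andbT lee_fin; exact: f0.
rewrite /Rintegral /spectral_measure ge0_integral_measure_series//.
have -> : (fun n => \sum_(0 <= i < n)
    \int[mscale (NngNum (sqr_ge0 (drift A xi (gpsi i)))) (dirac (lam i))]_(t in
      `]0%R, +oo[) (f t)%:E)%E =
   (fun n => (\sum_(0 <= i < n) drift A xi (gpsi i) ^+ 2 * f (lam i))%:E).
  apply/funext => n; rewrite -sumEFin; apply: eq_bigr => i _.
  rewrite ge0_integral_mscale// integral_dirac// diracE mem_set ?mul1e//=.
  by rewrite in_itv/= andbT; exact: eigen_gt0 hpsi i.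
have EFl : (\sum_(0 <= i < n) drift A xi (gpsi i) ^+ 2 * f (lam i))%:E
    @[n --> \oo] --> l%:E by apply: cvg_EFin; [exact: nearW|exact: fl].
by rewrite (cvg_lim (@ereal_hausdorff R) EFl).
Qed.

End correctors.

(** * Measurability of the spectral ratio and the resulting formula *)

Lemma spectral_den_continuous (R : realType) k (mu : R) :
  continuous (spectral_den k mu).
Proof.
elim: k => [|k IH] l.
  have -> : spectral_den 0 mu = (fun=> 1).
    by apply/funext => t; rewrite /spectral_den big_ord0.
  exact: cvg_cst.
have -> : spectral_den k.+1 mu =
    (fun t => spectral_den k mu t * (2 ^+ k * mu + t) ^+ 2).
  by apply/funext => t; rewrite /spectral_den big_ord_recr.
have H : (fun t => 2 ^+ k * mu + t) @ l --> 2 ^+ k * mu + l.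
  by apply: cvgD; [exact: cvg_cst|exact: cvg_id].
exact: (cvgM (IH l) (cvgM H H)).
Qed.

Lemma measurable_spectral_ratio (R : realType) k (mu : R) : 0 < mu ->
  measurable_fun (`]0, +oo[ : set R)
    (fun l => spectral_P k mu l / spectral_den k mu l).
Proof.
move=> m0; apply: open_continuous_measurable_fun; first exact: interval_open.
move=> l; rewrite inE/= in_itv/= andbT => l0.
have cD := @spectral_den_continuous R k mu l.
have D0 := spectral_den_gt0 k m0 l0.
have cV : (fun t : R => t^-1) @ l --> l^-1.
  by apply: cvgV; [rewrite gt_eqF|exact: cvg_id].
have cN : (fun t => spectral_den k mu t - 2 ^+ (k * k.-1) * mu ^+ (2 * k)) @ l -->
    spectral_den k mu l - 2 ^+ (k * k.-1) * mu ^+ (2 * k).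
  by apply: cvgB => //; exact: cvg_cst.
have cI : (fun t => (spectral_den k mu t)^-1) @ l --> (spectral_den k mu l)^-1.
  by apply: cvgV => //; rewrite gt_eqF.
exact: (cvgM (cvgM cV cN) cI).
Qed.

Theorem proposition2 (R : realType) (d : nat) (alpha beta : R)
    (A : 'rV[R]_d -> 'M[R]_d) (hA : elliptic_coef alpha beta A)
    (psi : nat -> 'rV[R]_d -> R) (gpsi : nat -> 'rV[R]_d -> 'rV[R]_d)
    (lam : nat -> R) (hpsi : periodic_eigenbasis A psi gpsi lam)
    (c : nat -> R)
    (c1 : c 1%N = 1)
    (cS : forall k : nat, (1 <= k)%N -> c k.+1 = (2 / c k + 1)^-1)
    (a : nat -> nat -> R)
    (a10 : a 1%N 0%N = 1)
    (aS0 : forall k : nat, (1 <= k)%N -> a k.+1 0%N = c k * a k 0%N)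
    (aSi : forall k i : nat, (1 <= k)%N -> (1 <= i <= k - 1)%N ->
       a k.+1 i = c k * a k i - 2 ^ (1 - k%:Z) * c k * a k (i - 1)%N)
    (aSk : forall k : nat, (1 <= k)%N ->
       a k.+1 k = - 2 ^ (1 - k%:Z) * c k * a k (k - 1)%N)
    (eta : nat -> nat -> R)
    (eta10 : eta 1%N 0%N = 0)
    (etaSi : forall k i : nat, (1 <= k)%N -> (i <= k - 1)%N ->
       eta k.+1 i = eta k i +
         (2 ^+ (k * (k - 1) + i) - 2 ^+ (k ^ 2 + 1)) * a k.+1 i ^+ 2)
    (etaSk : forall k : nat, (1 <= k)%N ->
       eta k.+1 k = - 2 ^+ (k ^ 2) * a k.+1 k ^+ 2)
    (nu : nat -> nat -> nat -> R)
    (nuSk : forall k i : nat, (1 <= k)%N -> (i <= k - 1)%N ->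
       nu k.+1 i k =
         (2 ^+ (k * (k - 1) + i) - 3 * 2 ^+ (k ^ 2)) * a k.+1 i * a k.+1 k)
    (nuSij : forall k i j : nat, (1 <= k)%N -> (i < j <= k - 1)%N ->
       nu k.+1 i j = nu k i j +
         (2 ^+ (k * (k - 1)) * (2 ^+ i + 2 ^+ j) - 2 ^+ (k ^ 2 + 2)) *
         a k.+1 i * a k.+1 j)
    (mu : R) (hmu : 0 < mu) (k : nat) (hk : (1 <= k)%N)
    (Amuk : 'M[R]_d) (hAmuk : homogenized_approx A gpsi lam mu k Amuk)
    (xi : 'rV[R]_d)
    (phi : R -> 'rV[R]_d -> R) (gphi : R -> 'rV[R]_d -> 'rV[R]_d)
    (hphi : forall m : R, 0 < m -> modified_corrector A xi m (phi m) (gphi m)) :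
  dotV xi (appV Amuk xi) =
    avg (fun x => dotV (xi + gphi mu x) (appV (A x) (xi + gphi mu x)))
    + mu * (\sum_(0 <= i < k) eta k i * avg (fun x => phi (2 ^+ i * mu) x ^+ 2))
    + mu * (\sum_(0 <= i < k) \sum_(i.+1 <= j < k)
         nu k i j * avg (fun x => phi (2 ^+ i * mu) x * phi (2 ^+ j * mu) x)).
Proof.
case: k hk hAmuk => [//|n] _ [_ ->].
have m_gt0 i : 0 < 2 ^+ i * mu by rewrite mulr_gt0// exprn_gt0.
pose p (m : R) l := ip (phi m) (psi l).
pose dr l := drift A xi (gpsi l).
have pE m l : 0 < m -> p m l = dr l / (m + lam l).
  by move=> m0; exact: (corrector_coef hA hpsi m0 (hphi _ m0)).
pose w i j := ip (phi (2 ^+ i * mu)) (phi (2 ^+ j * mu)).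
(* The expected value of the spectral integral: the energy defect given by [corrector_energy], minus
   the corrector terms of the formula. *)
pose L := 2 * mu * ip (phi mu) (phi mu) + aform A (gphi mu) (gphi mu) -
  mu * corrector_form eta nu n.+1 w.
have -> : \int[spectral_measure A gpsi lam xi]_(l in `]0, +oo[)
   (spectral_P n.+1 mu l / spectral_den n.+1 mu l) = L.
  apply: (spectral_integral hpsi).
  - by move=> t t0; exact: (spectral_ratio_ge0 c1 cS a10 aS0 aSi aSk).
  - exact: measurable_spectral_ratio.
  (* At each eigenvalue, expand the ratio and absorb the squared drift coefficient into the
     resolvent factors, which turns them into products of corrector coefficients. *)
  have -> : (fun N => \sum_(0 <= l < N) drift A xi (gpsi l) ^+ 2 *
      (spectral_P n.+1 mu (lam l) / spectral_den n.+1 mu (lam l))) =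
    (fun N => \sum_(0 <= l < N) (2 * mu + lam l) * p mu l ^+ 2 -
       mu * corrector_form eta nu n.+1 (fun i j =>
         \sum_(0 <= l < N) p (2 ^+ i * mu) l * p (2 ^+ j * mu) l)).
    apply/funext => N; rewrite -corrector_form_sum mulr_sumr -sumrB.
    apply: eq_bigr => l _; have l0 := eigen_gt0 hpsi l.
    rewrite (spectral_ratio_expansion c1 cS a10 aS0 aSi aSk
      eta10 etaSi etaSk nuSk nuSij)//.
    rewrite mulrBr [_ * (mu * _)]mulrCA -(corrector_formZ _ _ _ (_ ^+ 2)).
    congr (_ - mu * _).
      rewrite pE// expr_div_n /dr; ring.
    congr corrector_form; apply/funext => i; apply/funext => j.
    rewrite !pE//; ring.
  (* The first sum converges to the energy defect; the form converges because each entry of its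
     array does, by Parseval. *)
  apply: cvgB; first exact: (corrector_energy_cvg hA hpsi hmu (hphi _ hmu)).
  apply: cvgM; first exact: cvg_cst.
  apply: corrector_form_cvg => i j; apply: (parseval hpsi).
    exact: (L2_mean0_corrector (m_gt0 i) (hphi _ (m_gt0 i))).
  exact: (L2_mean0_corrector (m_gt0 j) (hphi _ (m_gt0 j))).
rewrite (corrector_energy hA (hphi _ hmu)) /L /corrector_form.
under [in RHS]eq_bigr do under eq_avg do rewrite expr2.
rewrite -/w; ring.
Qed.
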